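(* Let $M$ be the Markov-modulated Ornstein-Uhlenbeck process $$M(t)=m_0+\int_0^t(\alpha_{X(s)}-\gamma M(s))\,\mathrm ds+\int_0^t\sigma_{X(s)}\,\mathrm dB(s),\qquad t\ge0,$$ with $m_0\in\mathbb R$ and with mean-reversion parameter $\gamma_i\equiv\gamma>0$ the same in all states, and suppose that $X(0)$ has the invariant distribution $\boldsymbol\pi$. Then for every $t\ge0$ the mean $\mu_t:=\mathbb E M(t)$ and variance $v_t:=\mathrm{Var}\,M(t)$ are given by $$\mu_t=m_0e^{-\gamma t}+\frac{\boldsymbol\pi^{\rm T}\boldsymbol\alpha}{\gamma}\left(1-e^{-\gamma t}\right)$$ and $$v_t=\sum_{i=1}^d\pi_i\sigma_i^2\left(\frac{1-e^{-2\gamma t}}{2\gamma}\right)+\sum_{i=1}^d\sum_{j=1}^d\alpha_i\alpha_j\int_0^t\left(\frac{e^{-\gamma v}-e^{-\gamma(2t-v)}}{\gamma}\right)\pi_i\left(p_{ij}(v)-\pi_j\right)\mathrm dv .$$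
   Context: $X$ is a continuous-time Markov chain on $\{1,\dots,d\}$ with generator $Q$ and unique invariant distribution $\boldsymbol\pi=(\pi_1,\dots,\pi_d)^{\rm T}$; $p_{ij}(v):=\mathbb P(X(v)=j\mid X(0)=i)=(e^{Qv})_{ij}$. $B$ is a standard Brownian motion independent of $X$; $\alpha_i,\sigma_i\in\mathbb R$, and $\boldsymbol\alpha=(\alpha_1,\dots,\alpha_d)^{\rm T}$. *)

(* Defs.v *)
From mathcomp Require Import all_boot all_order all_algebra.
From mathcomp Require Import all_classical all_reals all_analysis.

Set Implicit Arguments.
Unset Strict Implicit.
Unset Printing Implicit Defensive.

Import Order.TTheory GRing.Theory Num.Theory.
Import numFieldNormedType.Exports.

Local Open Scope classical_set_scope.
Local Open Scope ring_scope.

Section generator.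
Context {R : realType} {d : nat}.

(* Entrywise sum of the exponential series. *)
Definition expmx (A : 'M[R]_d) : 'M[R]_d :=
  \matrix_(i, j) limn (series (fun k => (A ^+ k) i j / k`!%:R)).

Definition is_generator (Q : 'M[R]_d) :=
  (forall i j, i != j -> 0 <= Q i j) /\ (forall i, \sum_j Q i j = 0).

Definition transition (Q : 'M[R]_d) (v : R) : 'M[R]_d := expmx (v *: Q).

Definition is_distribution (p : 'I_d -> R) :=
  (forall i, 0 <= p i) /\ \sum_i p i = 1.

Definition is_invariant (Q : 'M[R]_d) (p : 'I_d -> R) :=
  is_distribution p /\ forall j, \sum_i p i * Q i j = 0.

Definition is_unique_invariant (Q : 'M[R]_d) (p : 'I_d -> R) :=
  is_invariant Q p /\ forall q, is_invariant Q q -> q = p.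

End generator.

Section processes.
Context {disp : measure_display} {T : measurableType disp} {R : realType}.
Variable P : probability T R.
Local Notation mu := lebesgue_measure.

Definition independent_systems (F G : set (set T)) :=
  forall A B, F A -> G B -> P (A `&` B) = (P A * P B)%E.

(* The events {Y s \in C} with s \in D and C \in S; the sigma-algebra of the
   process Y over the times D is the one these generate. *)
Definition path_events (E : Type) (S : set (set E)) (Y : R -> T -> E)
    (D : set R) : set (set T) :=
  \bigcup_(s in D) preimage_set_system [set: T] (Y s) S.

Section markov_chain.
Context {d : nat}.

(* Only times t >= 0 matter.  The Markov property is written in product form,
   so that conditioning events of probability zero need no special treatment. *)
Definition is_markov_chain (Q : 'M[R]_d) (X : R -> T -> 'I_d) :=
  [/\ forall (t : R) i, 0 <= t -> measurable (X t @^-1` [set i]),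
      forall w (t : R), 0 <= t -> \forall s \near t^'+, X s w = X t w
    & forall (n : nat) (t : nat -> R) (i : nat -> 'I_d),
        0 <= t 0%N -> {homo t : k l / (k <= l)%N >-> k <= l} ->
        P (\bigcap_(k < n.+2) (X (t k) @^-1` [set i k])) =
        ((transition Q (t n.+1 - t n) (i n) (i n.+1))%:E *
         P (\bigcap_(k < n.+1) (X (t k) @^-1` [set i k])))%E].

End markov_chain.

(* [normal_prob m s] is parameterized by the standard deviation [s], and is not
   the Dirac mass when s = 0, whence the strict inequality in the last clause. *)
Definition is_brownian_motion (B : R -> {RV P >-> R}) :=
  [/\ {ae P, forall w, B 0 w = 0},
      {ae P, forall w, {within `[0, +oo[, continuous (fun t : R => B t w)}},
      forall s t : R, 0 <= s <= t ->
        independent_systems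
          (preimage_set_system [set: T] (fun w => B t w - B s w) measurable)
          <<s path_events measurable B `[0, s] >>
    & forall s t : R, 0 <= s < t -> forall A, measurable A ->
        P ((fun w => B t w - B s w) @^-1` A) =
        normal_prob 0 (Num.sqrt (t - s)) A].

(* The simple process
     \sum_(k < sp_size) sp_coef k * 1_(sp_time k, sp_time k.+1]. *)
Record simple_process (F : R -> set (set T)) := SimpleProcess {
  sp_size : nat;
  sp_time : nat -> R;
  sp_coef : nat -> T -> R;
  sp_time_ge0 : 0 <= sp_time 0%N;
  sp_time_homo : {homo sp_time : k l / (k <= l)%N >-> k <= l};
  sp_coef_adapted : forall k A, measurable A ->
    F (sp_time k) (sp_coef k @^-1` A);
  sp_coef_bounded : forall k, exists C, forall w, `|sp_coef k w| <= C }.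

Definition sp_val (F : R -> set (set T)) (S : simple_process F) (t : R)
    (w : T) : R :=
  \sum_(k < sp_size S)
    sp_coef S k w * \1_(`]sp_time S k, sp_time S k.+1]) t.

Definition sp_integral (F : R -> set (set T)) (S : simple_process F)
    (B : R -> T -> R) (t : R) (w : T) : R :=
  \sum_(k < sp_size S)
    sp_coef S k w *
    (B (Num.min (sp_time S k.+1) t) w - B (Num.min (sp_time S k) t) w).

(* I is (a version of) the Ito integral process I_t = \int_0^t H_s dB_s of the
   L^2 theory: simple F-adapted processes approximate H in L^2(P * ds) on every
   [0, t], and their elementary integrals converge to I_t in L^2(P).  By the Ito
   isometry I_t does not depend, up to a null set, on the approximating
   sequence.  Meaningful for jointly measurable H and an F-Brownian motion B. *)
Definition is_ito_integral (F : R -> set (set T)) (B : R -> T -> R)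
    (H : R -> T -> R) (I : R -> {RV P >-> R}) :=
  exists S : nat -> simple_process F, forall t : R, 0 <= t ->
    (\int[P]_w \int[mu]_(s in `[0%R, t])
        ((sp_val (S n) s w - H s w) ^+ 2)%R%:E)%E @[n --> \oo] --> 0%E /\
    (\int[P]_w ((I t w - sp_integral (S n) B t w) ^+ 2)%R%:E)%E
        @[n --> \oo] --> 0%E.

Section mmou.
Context {d : nat}.

Definition joint_filtration (X : R -> T -> 'I_d) (B : R -> {RV P >-> R})
    (t : R) : set (set T) :=
  <<s path_events [set: set 'I_d] X `[0, t] `|`
      path_events measurable B `[0, t] >>.

Definition independent_processes (X : R -> T -> 'I_d)
    (B : R -> {RV P >-> R}) :=
  independent_systems <<s path_events [set: set 'I_d] X `[0, +oo[ >>
                      <<s path_events measurable B `[0, +oo[ >>.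

(* M is a continuous solution of
     M_t = m0 + \int_0^t (alpha_{X_s} - gamma M_s) ds
              + \int_0^t sigma_{X_s} dB_s.  *)
Definition is_mmou (X : R -> T -> 'I_d) (B : R -> {RV P >-> R}) (m0 : R)
    (alpha : 'I_d -> R) (gamma : R) (sigma : 'I_d -> R)
    (M : R -> {RV P >-> R}) :=
  {ae P, forall w, {within `[0, +oo[, continuous (fun t : R => M t w)}} /\
  exists2 I : R -> {RV P >-> R},
    is_ito_integral (joint_filtration X B) B (fun s w => sigma (X s w)) I &
    forall t : R, 0 <= t ->
      {ae P, forall w, M t w =
         m0 + \int[mu]_(s in `[0, t]) (alpha (X s w) - gamma * M s w)
            + I t w}.

End mmou.
End processes.

(* Main.v *)
Require Import Defs.
From mathcomp Require Import all_boot all_order all_algebra.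
From mathcomp Require Import all_classical all_reals all_analysis.
From mathcomp Require Import measurable_realfun.
From mathcomp Require Import ring lra.

(** Write [I] for the Ito integral of [sigma (X s)].  The paths of
    [G s = M s + gamma * \int_0^s M] are continuous, and for each [s] almost
    surely [G s = m0 + \int_0^s alpha (X u) du + I s].  Solving the linear
    equation pathwise gives
      [M t = G t - gamma * \int_0^t e^(- gamma (t - s)) G s ds],
    so for square integrable [Z], by Fubini,
      [E (Z M t) = m0 e^(- gamma t) E Z
         + \int_0^t e^(- gamma (t - u)) E (Z alpha (X u)) du
         + E (Z I t) - gamma \int_0^t e^(- gamma (t - s)) E (Z I s) ds].
    Taking [Z = 1] yields the mean; [Z = I r] and [Z = alpha (X u)] yield the
    inputs needed for [Z = M t], which yields the second moment.  The moments
    fed into this formula are [E (I r I s) = v * min r s], where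
    [v = \sum_i p i * sigma i ^+ 2] (Ito isometry and stationarity),
    [E (alpha (X u) I s) = 0] (the increments of [B] are independent of the past
    of [B] together with the whole path of [X]), and
    [E (alpha (X u) alpha (X s)) = c `|u - s| + (E alpha (X 0)) ^+ 2], with [c] the
    autocovariance function of [alpha (X u)]. *)

Set Implicit Arguments.
Unset Strict Implicit.
Unset Printing Implicit Defensive.

Import Order.TTheory GRing.Theory Num.Theory.
Import numFieldNormedType.Exports.

Local Open Scope classical_set_scope.
Local Open Scope ring_scope.

(** * Square integrable functions and Fubini *)

(** [is_ito_integral] determines [I t] only as an element of L^2 for each fixed [t], and the
    equation for [M] holds off a null set that depends on [t]. Pathwise calculus is therefore
    applied to [M] alone, whose paths are continuous, and [I] enters only through expectations at
    fixed times. All that is needed from stochastic integration is then a few inner products of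
    simple integrals and their limits in L^2.

    Square integrability of [M] has to be proved before [Z = M t] may serve as a test variable. It
    comes from the representation through [G]: the drift [alpha (X u)] is bounded because there are
    finitely many states, and [E (I s ^+ 2) = v * s], so [G s] is bounded in L^2 uniformly on
    [[0, t]], and its discounted integral is in L^2 too.

    In the second moment the chain contributes a double integral of [c] at [|u - s|] against two
    discount factors. Integrating over the position of the pair at fixed lag leaves the single
    integral of the statement. The terms coming from the mean add up to its square and cancel in the
    variance. *)

Section integrable_real.
Context (d : measure_display) (T : measurableType d) (R : realType).
Variables (mu : {measure set T -> \bar R}) (D : set T).
Hypothesis mD : measurable D.
Implicit Types f g : T -> R.

Lemma integrableD_EFin f g : mu.-integrable D (EFin \o f) ->
  mu.-integrable D (EFin \o g) -> mu.-integrable D (EFin \o (fun x => f x + g x)).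
Proof. by move=> hf hg; exact: (integrableD mD hf hg). Qed.

Lemma integrableB_EFin f g : mu.-integrable D (EFin \o f) ->
  mu.-integrable D (EFin \o g) -> mu.-integrable D (EFin \o (fun x => f x - g x)).
Proof. by move=> hf hg; exact: (integrableB mD hf hg). Qed.

Lemma integrableZl_EFin c f : mu.-integrable D (EFin \o f) ->
  mu.-integrable D (EFin \o (fun x => c * f x)).
Proof. by move=> hf; exact: (integrableZl mD c hf). Qed.

End integrable_real.

Section square_integrable.
Context (d : measure_display) (T : measurableType d) (R : realType).
Variables (mu : {measure set T -> \bar R}) (D : set T).
Hypothesis mD : measurable D.
Implicit Types f g h : T -> R.

Definition L2 f :=
  measurable_fun D f /\ mu.-integrable D (fun x => (f x ^+ 2)%:E).

Lemma L2_integrableM f g : L2 f -> L2 g ->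
  mu.-integrable D (EFin \o (fun x => f x * g x)).
Proof.
move=> [mf if2] [mg ig2].
apply: (@le_integrable _ _ _ _ _ mD _ (fun x => (f x ^+ 2)%:E + (g x ^+ 2)%:E)%E);
  last exact: integrableD.
  by apply/measurable_EFinP; exact: measurable_funM.
move=> x Dx /=; rewrite lee_fin [leRHS]ger0_norm ?addr_ge0 ?sqr_ge0//.
rewrite ler_norml; apply/andP; split; nra.
Qed.

Lemma L2D f g : L2 f -> L2 g -> L2 (fun x => f x + g x).
Proof.
move=> Lf Lg; have ifg := L2_integrableM Lf Lg.
case: Lf Lg => [mf if2] [mg ig2]; split; first exact: measurable_funD.
have h : mu.-integrable D (fun x => (f x ^+ 2)%:E + (g x ^+ 2)%:E +
   2%:E * (f x * g x)%:E)%E.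
  apply: integrableD => //; first exact: integrableD.
  exact: integrableZl.
by apply: eq_integrable h => // x _ /=; rewrite -EFinM -!EFinD; congr EFin; ring.
Qed.

Lemma L2Z c f : L2 f -> L2 (fun x => c * f x).
Proof.
move=> [mf if2]; split; first exact: measurable_funM.
have h : mu.-integrable D (fun x => (c ^+ 2)%:E * (f x ^+ 2)%:E)%E.
  exact: integrableZl.
by apply: eq_integrable h => // x _; rewrite -EFinM exprMn.
Qed.

Lemma L2B f g : L2 f -> L2 g -> L2 (fun x => f x - g x).
Proof.
move=> Lf /(L2Z (-1)) Lg; have := L2D Lf Lg.
by congr L2; apply/funext => x; rewrite mulN1r.
Qed.

Lemma L2_le f g : measurable_fun D f -> L2 g ->
  (forall x, D x -> `|f x| <= `|g x|) -> L2 f.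
Proof.
move=> mf [mg ig] fg; split=> //.
apply: le_integrable ig => //.
  by apply/measurable_EFinP; exact: measurable_funX.
move=> x Dx /=; rewrite lee_fin !normrX lerXn2r ?nnegrE//; exact: fg.
Qed.

Lemma L2_bounded f C : (mu D < +oo)%E -> measurable_fun D f ->
  (forall x, D x -> `|f x| <= C) -> L2 f.
Proof.
move=> Doo mf fC; split=> //.
apply: measurable_bounded_integrable => //; first exact: measurable_funX.
exists (C ^+ 2); split; first exact: num_real.
move=> y Cy x Dx /=; apply: (le_trans _ (ltW Cy)).
rewrite normrX lerXn2r ?nnegrE ?fC//.
by rewrite (le_trans _ (fC _ Dx)).
Qed.

Lemma L2_sum (n : nat) (F : 'I_n -> T -> R) :
  (forall k, L2 (F k)) -> L2 (fun x => \sum_(k < n) F k x).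
Proof.
elim: n F => [|n ih] F LF.
  split; first by under eq_fun do rewrite big_ord0; exact: measurable_cst.
  by under eq_fun do rewrite big_ord0 expr0n; exact: integrable0.
under eq_fun do rewrite big_ord_recr/=.
by apply: L2D => //; apply: ih.
Qed.

(** The quadratic form in [key] is the integral of a square, hence nonnegative; a suitable choice of
    its two arguments bounds [c ^+ 2]. *)
Lemma L2_Cauchy_Schwarz f g : L2 f -> L2 g ->
  `|\int[mu]_(x in D) (f x * g x)| <=
  Num.sqrt (\int[mu]_(x in D) f x ^+ 2) * Num.sqrt (\int[mu]_(x in D) g x ^+ 2).
Proof.
move=> Lf Lg; have ifg := L2_integrableM Lf Lg.
set a := \int[mu]_(x in D) f x ^+ 2; set b := \int[mu]_(x in D) g x ^+ 2.
set c := \int[mu]_(x in D) (f x * g x).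
have a0 : 0 <= a by apply: Rintegral_ge0 => x _; exact: sqr_ge0.
have b0 : 0 <= b by apply: Rintegral_ge0 => x _; exact: sqr_ge0.
have key u v : 0 <= u ^+ 2 * a + 2 * u * v * c + v ^+ 2 * b.
  have -> : u ^+ 2 * a + 2 * u * v * c + v ^+ 2 * b =
     \int[mu]_(x in D) (u * f x + v * g x) ^+ 2.
    transitivity (\int[mu]_(x in D) ((u ^+ 2 * f x ^+ 2 +
        2 * u * v * (f x * g x)) + v ^+ 2 * g x ^+ 2)); last first.
      by apply: eq_Rintegral => x _; ring.
    have i1 : mu.-integrable D (EFin \o (fun x => u ^+ 2 * f x ^+ 2)).
      by apply: integrableZl_EFin => //; exact: Lf.2.
    have i2 : mu.-integrable D (EFin \o (fun x => 2 * u * v * (f x * g x))).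
      exact: integrableZl_EFin.
    have i3 : mu.-integrable D (EFin \o (fun x => v ^+ 2 * g x ^+ 2)).
      by apply: integrableZl_EFin => //; exact: Lg.2.
    rewrite RintegralD//; last exact: (integrableD mD i1 i2).
    rewrite RintegralD// !RintegralZl//; [exact: Lg.2|exact: Lf.2].
  by apply: Rintegral_ge0 => x _; exact: sqr_ge0.
have c2 : c ^+ 2 <= a * b.
  (* If [b = 0], the form at [c] and [- (a + 1)] equals [- c ^+ 2 * (a + 2)], which forces [c = 0].
     Otherwise its value at [b] and [- c] is [b * (a * b - c ^+ 2)]. *)
  have [b1|b1] := eqVneq b 0.
    have := key c (- (a + 1)); rewrite b1 !mulr0 addr0 => h.
    have := sqr_ge0 c; nra.
  have bp : 0 < b by rewrite lt_neqAle eq_sym b1.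
  have := key b (- c); rewrite -(@ler_pM2r _ b)//; nra.
rewrite -sqrtrM// -sqrtr_sqr ler_wsqrtr//.
Qed.

(** The convergence has the form found in [is_ito_integral]. Extended reals tending to 0 are
    eventually finite, so some [f - F N] is square integrable, and with it [f]. *)
Lemma L2_cvg f (F : nat -> T -> R) : measurable_fun D f -> (forall n, L2 (F n)) ->
  (\int[mu]_(x in D) ((f x - F n x) ^+ 2)%:E)%E @[n --> \oo] --> 0%E ->
  L2 f /\ (\int[mu]_(x in D) (f x - F n x) ^+ 2) @[n --> \oo] --> 0.
Proof.
move=> mf LF h; split; last exact: (fine_cvg h).
have [N _ hN] : \forall n \near \oo,
    (\int[mu]_(x in D) ((f x - F n x) ^+ 2)%:E < +oo)%E.
  have /fine_cvgP[+ _] := h.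
  by apply: filterS => n; rewrite ge0_fin_numE// integral_ge0// => x _;
     rewrite lee_fin sqr_ge0.
have LD : L2 (fun x => f x - F N x).
  have mfF : measurable_fun D (fun x => f x - F N x).
    by apply: measurable_funB => //; exact: (LF N).1.
  split=> //; apply/integrableP; split.
    by apply/measurable_EFinP; exact: measurable_funX.
  have := hN N (leqnn N); apply: le_lt_trans.
  apply: ge0_le_integral => //=.
  - apply/measurable_EFinP/measurableT_comp => //.
    by apply: measurable_funX.
  - by apply/measurable_EFinP; exact: measurable_funX.
  - by move=> x _; rewrite lee_fin ger0_norm// sqr_ge0.
have := L2D LD (LF N).
by congr L2; apply/funext => x; rewrite subrK.
Qed.

(** The difference of the products is [(f - F n) * g + f * (g - G n) - (f - F n) * (g - G n)], and
    Cauchy-Schwarz bounds the three terms by those of [b n]. *)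
Lemma L2_cvg_inner f g (F G : nat -> T -> R) :
  L2 f -> L2 g -> (forall n, L2 (F n)) -> (forall n, L2 (G n)) ->
  (\int[mu]_(x in D) (f x - F n x) ^+ 2) @[n --> \oo] --> 0 ->
  (\int[mu]_(x in D) (g x - G n x) ^+ 2) @[n --> \oo] --> 0 ->
  (\int[mu]_(x in D) (F n x * G n x)) @[n --> \oo] -->
    \int[mu]_(x in D) (f x * g x).
Proof.
move=> Lf Lg LF LG fF gG.
pose N h := Num.sqrt (\int[mu]_(x in D) h x ^+ 2).
pose e n := N (fun x => f x - F n x); pose e' n := N (fun x => g x - G n x).
have sqrt0 : Num.sqrt (0 : R) = 0 by rewrite sqrtr0.
have e0 : e n @[n --> \oo] --> 0.
  rewrite -[X in _ --> X]sqrt0.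
  exact: (continuous_cvg _ (@sqrt_continuous R 0)).
have e'0 : e' n @[n --> \oo] --> 0.
  rewrite -[X in _ --> X]sqrt0.
  exact: (continuous_cvg _ (@sqrt_continuous R 0)).
pose b n := e n * N g + N f * e' n + e n * e' n.
have b0 : b n @[n --> \oo] --> 0.
  have -> : (0 : R) = 0 * N g + N f * 0 + 0 * 0 by ring.
  apply: cvgD; first apply: cvgD.
  - by apply: cvgMl.
  - by apply: cvgMr.
  - exact: cvgM.
apply/cvgrPdist_le => eps eps0.
have /cvgrPdist_le /(_ _ eps0) := b0.
apply: filterS => n; rewrite sub0r normrN => hb.
have LfF := L2B Lf (LF n); have LgG := L2B Lg (LG n).
apply: le_trans (le_trans (ler_norm _) hb).
have -> : \int[mu]_(x in D) (f x * g x) - \int[mu]_(x in D) (F n x * G n x) =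
  \int[mu]_(x in D) ((f x - F n x) * g x) + \int[mu]_(x in D) (f x * (g x - G n x))
  - \int[mu]_(x in D) ((f x - F n x) * (g x - G n x)).
  rewrite -RintegralB//; [|exact: L2_integrableM..].
  have h1 := L2_integrableM LfF Lg; have h2 := L2_integrableM Lf LgG.
  rewrite -RintegralD// -RintegralB//; last 2 first.
  - exact: (integrableD mD h1 h2).
  - exact: L2_integrableM.
  by apply: eq_Rintegral => x _; ring.
rewrite (le_trans (ler_normB _ _))// lerD//; last exact: L2_Cauchy_Schwarz.
by rewrite (le_trans (ler_normD _ _))// lerD//; exact: L2_Cauchy_Schwarz.
Qed.

End square_integrable.

Section Fubini_real.
Context (d1 d2 : measure_display) (T1 : measurableType d1)
  (T2 : measurableType d2) (R : realType).
Variables (m1 : {sigma_finite_measure set T1 -> \bar R})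
  (m2 : {sigma_finite_measure set T2 -> \bar R}).
Variables (D1 : set T1) (D2 : set T2).
Hypotheses (mD1 : measurable D1) (mD2 : measurable D2).
Variables (f : T1 * T2 -> R) (C : R).
Hypothesis mf : measurable_fun [set: T1 * T2] f.
Hypothesis D1oo : (m1 D1 < +oo)%E.
Hypothesis fC : forall x, D1 x -> (\int[m2]_(y in D2) `|f (x, y)|%:E <= C%:E)%E.

(** Extension by 0 outside the rectangle, so that the theorems for the product measure on the whole
    space apply; [fC] and the finiteness of [m1 D1] make it integrable. *)
Let g : T1 * T2 -> \bar R := fun z => (f z * (\1_D1 z.1 * \1_D2 z.2))%:E.

Let mg : measurable_fun setT g.
Proof.
apply/measurable_EFinP; apply: measurable_funM => //.
apply: measurable_funM.
  exact: (measurableT_comp (measurable_indic mD1) measurable_fst).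
exact: (measurableT_comp (measurable_indic mD2) measurable_snd).
Qed.

Let gE2 x : (\int[m2]_y g (x, y) =
  (\1_D1 x)%:E * \int[m2]_(y in D2) (f (x, y))%:E)%E.
Proof.
rewrite /g /= indicE; have [xD1|xD1] /= := boolP (x \in D1).
  rewrite mul1e [RHS]integral_mkcond; apply: eq_integral => y _.
  by rewrite /patch indicE; case: ifP => _ /=; rewrite !mul1r ?mulr1 ?mulr0.
rewrite mul0e; under eq_integral do rewrite mul0r mulr0.
by rewrite integral0.
Qed.

Let gE1 y : (\int[m1]_x g (x, y) =
  (\1_D2 y)%:E * \int[m1]_(x in D1) (f (x, y))%:E)%E.
Proof.
rewrite /g /= indicE; have [yD2|yD2] /= := boolP (y \in D2).
  rewrite mul1e [RHS]integral_mkcond; apply: eq_integral => x _.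
  by rewrite /patch indicE; case: ifP => _ /=; rewrite ?mulr1 ?mulr0.
rewrite mul0e; under eq_integral do rewrite mulr0 mulr0.
by rewrite integral0.
Qed.

Let ig : (m1 \x m2)%E.-integrable setT g.
Proof.
apply/integrable12ltyP => //.
apply: (@le_lt_trans _ _ (\int[m1]_(x in D1) (cst `|C|%:E) x)%E); last first.
  by rewrite integral_cst// lte_mul_pinfty// ?lee_fin// fin_num_fun.
rewrite [leRHS]integral_mkcond; apply: ge0_le_integral => //=.
- by move=> x _; exact: integral_ge0.
- apply: (measurable_fun_fubini_tonelli_F (abse \o g)) => //=.
  exact: measurableT_comp.
- apply/measurable_restrict => //; exact: measurable_cst.
move=> x _; rewrite /patch; case: ifPn => xD1; last first.
  under eq_integral do rewrite /g /= indicE (negbTE xD1) mul0r mulr0 normr0.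
  by rewrite integral0.
apply: (@le_trans _ _ C%:E); last by rewrite lee_fin ler_norm.
apply: le_trans (fC (set_mem xD1)).
rewrite [leRHS]integral_mkcond le_eqVlt; apply/orP; left; apply/eqP.
apply: eq_integral => y _.
rewrite /g /patch /= !indicE xD1 mul1r.
by case: ifP => _; rewrite ?mulr1// mulr0 normr0.
Qed.

Let F1fin x : D1 x -> (\int[m2]_(y in D2) (f (x, y))%:E)%E \is a fin_num.
Proof.
move=> D1x; apply: integrable_fin_num => //; apply/integrableP; split.
  apply/measurable_EFinP; apply: measurable_funTS.
  exact: (measurableT_comp mf (measurable_pair1 x)).
exact: le_lt_trans (fC D1x) (ltry _).
Qed.

Lemma Fubini_integrable1 :
  m1.-integrable D1 (EFin \o (fun x => \int[m2]_(y in D2) f (x, y))).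
Proof.
have h : m1.-integrable D1 (fun x => \int[m2]_y g (x, y))%E.
  by apply: (integrableS measurableT) => //; exact: integrable_fubini_F ig.
apply: eq_integrable h => // x /set_mem D1x.
by rewrite gE2 indicE mem_set// mul1e /= fineK// F1fin.
Qed.

Let iG : m2.-integrable D2 (fun y => \int[m1]_(x in D1) (f (x, y))%:E)%E.
Proof.
have h : m2.-integrable D2 (fun y => \int[m1]_x g (x, y))%E.
  apply: (integrableS measurableT) => //.
  apply/integrableP; split; first exact: measurable_fubini_G ig.
  apply: le_lt_trans ((integrable21ltyP _ _ mg).1 ig).
  apply: ge0_le_integral => //=.
  - by apply: measurableT_comp => //; exact: measurable_fubini_G ig.
  - apply: (measurable_fun_fubini_tonelli_G (abse \o g)) => //=.
    exact: measurableT_comp.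
  - move=> y _; apply: le_abse_integral => //.
    exact: (measurableT_comp mg (measurable_pair2 y)).
apply: eq_integrable h => // y yD2.
by rewrite gE1 indicE yD2 mul1e.
Qed.

(** For some [y] the integral over [D1] may be infinite. [Rintegral] is then 0, so in absolute value
    it stays below the extended integral, which is integrable by [iG]. *)
Lemma Fubini_integrable2 :
  m2.-integrable D2 (EFin \o (fun y => \int[m1]_(x in D1) f (x, y))).
Proof.
apply: le_integrable iG => //.
  apply: measurableT_comp => //; apply: measurableT_comp => //.
  exact: measurable_int iG.
move=> y _ /=; rewrite /Rintegral.
by case: (\int[m1]_(x in D1) _)%E => [r| |] //=; rewrite normr0 leey.
Qed.

Lemma Fubini_Rintegral :
  \int[m1]_(x in D1) \int[m2]_(y in D2) f (x, y) =
  \int[m2]_(y in D2) \int[m1]_(x in D1) f (x, y).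
Proof.
congr fine; transitivity (\int[m1]_x \int[m2]_y g (x, y))%E.
  rewrite integral_mkcond; apply: eq_integral => x _.
  rewrite gE2 indicE /patch; case: ifPn => xD1; last by rewrite mul0e.
  by rewrite mul1e fineK// F1fin//; exact: set_mem.
rewrite (Fubini ig) [RHS](_ : _ =
  \int[m2]_(y in D2) \int[m1]_(x in D1) (f (x, y))%:E)%E.
  rewrite [RHS]integral_mkcond; apply: eq_integral => y _.
  by rewrite gE1 indicE /patch; case: ifPn => yD; rewrite ?mul1e ?mul0e.
(* [fine] alters the inner integral only where it is infinite, a null set by integrability. *)
apply: ae_eq_integral => //.
- exact: measurable_int Fubini_integrable2.
- exact: measurable_int iG.
have := integrable_ae mD2 iG; apply: filterS => y h D2y.
by rewrite /= fineK// h.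
Qed.

End Fubini_real.

(** * Joint measurability of right-continuous processes *)

Section joint_measurability.
Context (d : measure_display) (T : measurableType d) (R : realType).
Variable Y : R -> T -> R.
Hypothesis mY : forall s : R, 0 <= s -> measurable_fun setT (Y s).
Hypothesis rcY : forall w (s : R), 0 <= s -> Y u w @[u --> s^'+] --> Y s w.

Let step (n : nat) (s : R) : nat := Num.truncn (Num.max s 0 * n.+1%:R).

(** Time is rounded up to a point of the grid of mesh [1 / n.+1]. The rounded process is constant in
    time on each cell, so its preimages are countable unions of rectangles, and right continuity
    gives the limit. Negative times carry the value at time 0. *)
Lemma right_continuous_jointly_measurable :
  measurable_fun setT (fun z : R * T => Y (Num.max z.1 0) z.2).
Proof.
pose h n (z : R * T) := Y ((step n z.1).+1%:R / n.+1%:R) z.2.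
apply: (@measurable_fun_cvg _ _ _ _ h).
  move=> n _ A mA; rewrite setTI.
  rewrite [X in measurable X](_ : _ = \bigcup_k
     ((step n @^-1` [set k]) `*` (Y (k.+1%:R / n.+1%:R) @^-1` A))).
    apply: bigcupT_measurable => k; apply: measurableX; last first.
      by rewrite -[X in measurable X]setTI; apply: mY.
    have mstep : measurable_fun setT (fun s : R => Num.max s 0 * n.+1%:R).
      apply: measurable_funM => //; apply: measurable_maxr => //.
    have := mstep measurableT [set` `[k%:R, k.+1%:R[] (measurable_itv _).
    rewrite setTI; congr measurable; apply/seteqP; split => s /=.
      rewrite in_itv /= /step => /andP[h1 h2].
      by apply/eqP; rewrite truncn_eq// ?h1 ?h2// mulr_ge0// le_max lexx orbT.
    rewrite /step => <-; rewrite in_itv /=.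
    by rewrite truncn_itv// mulr_ge0// le_max lexx orbT.
  apply/seteqP; split => [[s w]|[s w] [k _ [/= <-]]] //=.
  by move=> hA; exists (step n s).
move=> [s w] _; rewrite /h /=.
set x := Num.max s 0; have x0 : 0 <= x by rewrite le_max lexx orbT.
(* Strict on the left, since the limit at [x^'+] is tested along points greater than [x]; this is
   why [step] is followed by a successor. *)
have bnd n : x < (step n s).+1%:R / n.+1%:R <= x + n.+1%:R^-1.
  have /andP[h1 h2] : (step n s)%:R <= x * n.+1%:R < (step n s).+1%:R.
    by apply: truncn_itv; rewrite mulr_ge0.
  rewrite ltr_pdivlMr// h2 /= ler_pdivrMr// mulrDl mulVf ?pnatr_eq0//.
  by rewrite -natr1 lerD2r.
have /cvg_at_rightP := @rcY w x x0; apply; split.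
  by move=> n; have /andP[] := bnd n.
apply: (@squeeze_cvgr _ _ _ _ (fun=> x) (fun n => x + n.+1%:R^-1)).
- by apply: nearW => n; have /andP[/ltW -> ->] := bnd n.
- exact: cvg_cst.
- rewrite -[X in _ --> X]addr0; apply: cvgD; first exact: cvg_cst.
  exact: cvg_harmonic.
Qed.

End joint_measurability.

Section FTC_global.
Context (R : realType).
Local Notation mu := (@lebesgue_measure R).

Lemma continuous_itv_integrable (f : R -> R) (a b : R) : continuous f ->
  mu.-integrable `[a, b] (EFin \o f).
Proof.
move=> cf; apply: continuous_compact_integrable; first exact: segment_compact.
exact: continuous_subspaceT.
Qed.

Lemma integral_FTC (F f : R -> R) (a b : R) : a <= b -> {in `[a, b], continuous f} ->
  (forall x : R, a <= x <= b -> is_derive x (1 : R) F (f x)) ->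
  (\int[mu]_(x in `[a, b]) (f x)%:E = (F b - F a)%:E)%E.
Proof.
rewrite le_eqVlt => /predU1P[<- _ _|ab cf dF].
  by rewrite set_itv1 integral_set1 subrr.
have cF x : a <= x <= b -> {for x, continuous F}.
  by move=> /dF dx; apply/differentiable_continuous/derivable1_diffP.
rewrite (@continuous_FTC2 R f F a b)//.
- apply: continuous_in_subspaceT => x /set_mem; exact: cf.
- split.
  + by move=> x; rewrite in_itv/= => /andP[ax xb]; have := dF x; rewrite !ltW// => -[].
  + by apply/cvg_at_right_filter/cF; rewrite lexx ltW.
  + by apply/cvg_at_left_filter/cF; rewrite lexx ltW.
- move=> x; rewrite in_itv/= => /andP[ax xb].
  by have := dF x; rewrite !ltW// => /(_ isT) h; rewrite derive1E derive_val.
Qed.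

Lemma Rintegral_FTC (F f : R -> R) (a b : R) : a <= b -> {in `[a, b], continuous f} ->
  (forall x : R, a <= x <= b -> is_derive x (1 : R) F (f x)) ->
  \int[mu]_(x in `[a, b]) f x = F b - F a.
Proof. by move=> ab cf dF; rewrite /Rintegral (integral_FTC ab cf dF). Qed.

End FTC_global.

(** * Moments of normal laws and independence *)

Section normal_moments.
Context (R : realType).
Local Notation mu := (@lebesgue_measure R).
Variable s : R.
Hypothesis s0 : 0 < s.
Let phi := normal_pdf 0 s.

(** The change of variables produces the Radon-Nikodym derivative; it agrees almost everywhere with
    [phi] because both have the same integral over every measurable set. *)
Lemma ge0_integral_normal_prob (f : R -> \bar R) :
  measurable_fun setT f -> (forall x, 0 <= f x)%E ->
  (\int[normal_prob 0%R s]_x f x = \int[mu]_x (f x * (phi x)%:E))%E.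
Proof.
move=> mf f0.
have dom := @normal_prob_dominates R 0 s.
rewrite -(Radon_Nikodym_SigmaFinite.change_of_variables dom)//.
have irn := Radon_Nikodym_SigmaFinite.f_integrable dom.
have mphi : measurable_fun [set: R] (EFin \o phi).
  by apply/measurable_EFinP; exact: measurable_normal_pdf.
apply: ae_eq_integral => //.
- by apply: emeasurable_funM => //; exact: measurable_int irn.
- exact: emeasurable_funM.
- apply: ae_eqe_mul2l => /=; apply: integral_ae_eq => //= E _ mE.
  by rewrite -(Radon_Nikodym_SigmaFinite.f_integral dom).
Qed.

Let phiE x : phi x = normal_peak s * expR (- x ^+ 2 / (s ^+ 2 *+ 2)).
Proof. by rewrite /phi normal_pdfE ?gt_eqF// /normal_fun subr0. Qed.

Let phi_ge0 x : 0 <= phi x. Proof. exact: normal_pdf_ge0. Qed.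

Let cphi : continuous phi.
Proof. by apply: continuous_normal_pdf; rewrite gt_eqF. Qed.

#[local] Instance phi_derive (x : R) : is_derive x (1 : R) phi (- (x / s ^+ 2) * phi x).
Proof.
rewrite (_ : phi = fun x => normal_peak s * expR (- x ^+ 2 / (s ^+ 2 *+ 2))).
  by apply: is_derive_eq; rewrite /GRing.scale /= -mulr_natr; field;
     rewrite gt_eqF.
by apply/funext => y; rewrite phiE.
Qed.

Let phi_even x : phi (- x) = phi x. Proof. by rewrite !phiE sqrrN. Qed.

Let nphi_cvg : (n%:R * phi n%:R) @[n --> \oo] --> 0.
Proof.
(* From [expR y >= y] at [y = n ^+ 2 / (2 s ^+ 2)]: the density at [n] is at most [c / n ^+ 2],
   hence [n] times it is at most [c / n]. *)
pose c := normal_peak s * (s ^+ 2 *+ 2).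
apply: (@squeeze_cvgr _ _ _ _ (fun=> 0) (fun n => c * n%:R^-1)).
- near=> n; have n0 : 0 < n%:R :> R by rewrite ltr0n; near: n; exists 1%N.
  rewrite mulr_ge0//= phiE /c mulrCA -mulrA ler_wpM2l ?normal_peak_ge0//.
  rewrite mulNr expRN ler_pdivlMr// mulrAC ler_pdivrMr ?expR_gt0//.
  rewrite -expr2 -ler_pdivrMl; last by rewrite pmulrn_lgt0// exprn_gt0.
  by rewrite mulrC (le_trans _ (expR_ge1Dx _))// lerDr.
- exact: cvg_cst.
- rewrite -(mulr0 c); apply: cvgMr.
  apply/gtr0_cvgV0; last exact: cvgr_idn.
  by near=> n; rewrite ltr0n; near: n; exists 1%N.
Unshelve. all: by end_near. Qed.

Let phi_half : (\int[mu]_(x in `[0%R, +oo[) (phi x)%:E = (2^-1)%:E)%E.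
Proof.
have := @integral_normal_pdf R 0 s.
rewrite (@ge0_symfun_integralT _ phi)//=; last by move=> x /=; rewrite phi_even.
rewrite (_ : [set x | _] = `[0, +oo[%classic); last first.
  by apply/seteqP; split => x/=; rewrite in_itv/= andbT.
move: (integral _ _ _) => [r| |] //=.
- by rewrite -EFinM => -[h]; congr EFin; lra.
- by rewrite mulry gtr0_sg// mul1e.
- by rewrite mulrNy gtr0_sg// mul1e.
Qed.

(** Integration by parts: [x ^+ 2 * phi x - s ^+ 2 * phi x] is the derivative of
    [- s ^+ 2 * (x * phi x)]. By evenness the half-line suffices; on [[0, n]] the boundary term
    vanishes in the limit by [nphi_cvg], and the half-line has mass 1/2. *)
Lemma normal_prob_second_moment :
  (\int[normal_prob 0%R s]_x (x ^+ 2)%:E = (s ^+ 2)%:E)%E.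
Proof.
have m2 : measurable_fun [set: R] (fun x : R => x ^+ 2) by exact: exprn_measurable.
rewrite ge0_integral_normal_prob//; last 2 first.
- exact/measurable_EFinP.
- by move=> x; rewrite lee_fin sqr_ge0.
pose f x := x ^+ 2 * phi x.
have cf : continuous f.
  by move=> x; apply: cvgM; [exact: exprn_continuous|exact: cphi].
have f0 x : 0 <= f x by rewrite mulr_ge0// sqr_ge0.
rewrite (@ge0_symfun_integralT _ f)//=; last first.
  by move=> x; rewrite /f /= phi_even sqrrN.
rewrite (_ : [set x | _] = `[0, +oo[%classic); last first.
  by apply/seteqP; split => x/=; rewrite in_itv/= andbT.
suff -> : (\int[mu]_(x in `[0%R, +oo[) (f x)%:E = (s ^+ 2 / 2)%:E)%E.
  by rewrite -EFinM; congr EFin; field.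
have mf : measurable_fun setT f by exact: continuous_measurable_fun.
have mphi : measurable_fun setT phi by exact: continuous_measurable_fun.
apply: (cvg_unique _ (@ge0_cvgn_integral R mu f f0 mf)) => //.
have I n : (\int[mu]_(x in `[0%R, n%:R]) (f x)%:E =
  (s ^+ 2)%:E * \int[mu]_(x in `[0%R, n%:R]) (phi x)%:E
   - (s ^+ 2 * (n%:R * phi n%:R))%:E)%E.
  have iphi : mu.-integrable `[0, n%:R] (EFin \o phi).
    exact: continuous_itv_integrable.
  have if_ : mu.-integrable `[0, n%:R] (EFin \o f).
    exact: continuous_itv_integrable.
  pose F x := - s ^+ 2 * (x * phi x).
  have dF (x : R) : is_derive x (1 : R) F (f x - s ^+ 2 * phi x).
    by apply: is_derive_eq; rewrite /GRing.scale /= /f; field; rewrite gt_eqF.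
  have cg : continuous (fun x => f x - s ^+ 2 * phi x).
    by move=> x; apply: cvgB; [exact: cf|apply: cvgMr; exact: cphi].
  have := integral_FTC (ler0n R n) (fun x _ => cg x) (fun x _ => dF x).
  rewrite /= integralB_EFin//; last exact: integrableZl_EFin.
  have fin1 : (\int[mu]_(x in `[0%R, n%:R]) (f x)%:E)%E \is a fin_num.
    exact: integrable_fin_num if_.
  have fin2 : (\int[mu]_(x in `[0%R, n%:R]) (phi x)%:E)%E \is a fin_num.
    exact: integrable_fin_num iphi.
  under [X in (_ - X)%E]eq_integral do rewrite EFinM.
  rewrite integralZl//=.
  case: (\int[mu]_(x in _) (f x)%:E)%E fin1 => [a| |]// _.
  case: (\int[mu]_(x in _) (phi x)%:E)%E fin2 => [b| |]// _.
  rewrite -EFinM -EFinB => -[h]; congr EFin; move: h; rewrite /F; lra.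
rewrite /mkset; under eq_fun do rewrite I.
have -> : (s ^+ 2 / 2)%:E = ((s ^+ 2)%:E * (2^-1)%:E - (s ^+ 2 * 0)%:E)%E.
  by rewrite mulr0 sube0 EFinM.
apply: cvgeB => //.
- apply: cvgeMl => //; rewrite -phi_half.
  by apply: ge0_cvgn_integral.
- by apply: cvg_EFin; [exact: nearW|exact: cvgMr].
Qed.

(** Integrability follows from [|x| <= 1 + x ^+ 2]. The mean vanishes because the reflection
    [x -> - x] exchanges the positive and negative parts and preserves the density. *)
Lemma normal_prob_first_moment :
  (normal_prob 0 s).-integrable setT (EFin \o id) /\
  (\int[normal_prob 0%R s]_x x%:E = 0)%E.
Proof.
have i2 : (normal_prob 0 s).-integrable setT (fun x : R => (x ^+ 2)%:E).
  have m2 : measurable_fun [set: measurableTypeR R] (fun x : R => x ^+ 2).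
    exact: exprn_measurable.
  apply/integrableP; split; first exact/measurable_EFinP.
  under eq_integral do rewrite abse_EFin ger0_norm ?sqr_ge0//.
  by rewrite normal_prob_second_moment ltry.
have i1 : (normal_prob 0 s).-integrable setT (EFin \o id).
  have h : (normal_prob 0 s).-integrable setT (EFin \o (fun x : R => 1 + x ^+ 2)).
    apply: integrableD_EFin => //.
    exact: finite_measure_integrable_cst.
  apply: le_integrable h => //; first exact/measurable_EFinP/measurable_id.
  move=> x _ /=; rewrite lee_fin [leRHS]ger0_norm ?addr_ge0 ?sqr_ge0//.
  rewrite ler_norml; apply/andP; split; nra.
split => //.
rewrite integralE.
have mp : measurable_fun setT ((EFin \o @id R)^\+)%E.
  by apply: measurable_funepos; exact: measurable_int i1.
have mn : measurable_fun setT ((EFin \o @id R)^\-)%E.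
  by apply: measurable_funeneg; exact: measurable_int i1.
rewrite !ge0_integral_normal_prob//.
suff <- : (\int[mu]_x ((EFin \o @id R)^\+ x * (phi x)%:E) =
   \int[mu]_x ((EFin \o @id R)^\- x * (phi x)%:E))%E.
  rewrite subee// -ge0_integral_normal_prob//.
  exact: integrable_pos_fin_num.
pose g x := Num.max (- x) 0 * phi x.
have cg : continuous g.
  move=> x; apply: cvgM; last exact: cphi.
  apply: continuous_max; [exact: opp_continuous|exact: cst_continuous].
transitivity (\int[mu]_(x in `[0%R, +oo[) ((g \o -%R) x)%:E)%E.
  rewrite [RHS]integral_mkcond; apply: eq_integral => x _.
  rewrite patchE mem_setE in_itv/= andbT /g opprK phi_even.
  rewrite funeposE /= -EFin_max EFinM; case: ifPn => // x0.
  by rewrite max_r ?mul0e// ltW// ltNge.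
rewrite -ge0_integration_by_substitutionNy; last 2 first.
- exact: continuous_subspaceT.
- by move=> x _; rewrite mulr_ge0// le_max lexx orbT.
rewrite oppr0 [LHS]integral_mkcond; apply: eq_integral => x _.
rewrite patchE mem_setE in_itv/= /g funenegE /= -EFin_max EFinM.
by case: ifPn => //; rewrite -ltNge => x0; rewrite max_r ?mul0e// oppr_le0 ltW.
Qed.

End normal_moments.

(** * Products of independent random variables *)

Section independence.
Context (d : measure_display) (T : measurableType d) (R : realType).
Variable P : probability T R.

Lemma L2_prob_bounded (f : T -> R) (C : R) : measurable_fun setT f ->
  (forall w, `|f w| <= C) -> L2 P setT f.
Proof.
move=> mf fC; apply: (@L2_bounded _ _ _ _ _ measurableT f C) => //.
exact: (le_lt_trans (probability_le1 P measurableT) (ltry _)).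
Qed.

Lemma L2_integrable (f : T -> R) : L2 P setT f -> P.-integrable setT (EFin \o f).
Proof.
move=> Lf; have L1 : L2 P setT (fun=> 1).
  by apply: (@L2_prob_bounded _ 1) => // w; rewrite normr1.
have := L2_integrableM measurableT Lf L1; congr integrable.
by apply/funext => w /=; rewrite mulr1.
Qed.

Definition mfunR (V : T -> R) (mV : measurable_fun setT V) :
    {mfun T >-> measurableTypeR R} :=
  @mfun_Sub _ _ T (measurableTypeR R) V (mem_set mV).

Section independent_product.
Variables U V : {mfun T >-> measurableTypeR R}.
Hypothesis UV : forall A B : set (measurableTypeR R), measurable A -> measurable B ->
  P (U @^-1` A `&` V @^-1` B) = (P (U @^-1` A) * P (V @^-1` B))%E.

Let mW : measurable_fun setT (fun w => (U w, V w)).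
Proof. exact: measurable_fun_pair. Qed.

Let W : {mfun T >-> (measurableTypeR R * measurableTypeR R)%type} :=
  mfun_Sub (mem_set mW).

Let lawE A : measurable A ->
  (distribution P U \x distribution P V)%E A = distribution P W A.
Proof.
apply: (@product_measure_unique _ _ _ _ _ (distribution P U) (distribution P V)
  (distribution P W)) => {}A B mA mB.
rewrite /distribution /pushforward -UV//; congr (P _).
Qed.

(** By [lawE] the joint law is the product of the two laws, since the two measures agree on
    rectangles. Under a product measure [x * y] is integrable by Tonelli and its iterated integral
    factorizes. *)
Lemma independent_integrableM : P.-integrable setT (EFin \o U) ->
  P.-integrable setT (EFin \o V) ->
  P.-integrable setT (EFin \o (fun w => U w * V w)) /\
  \int[P]_w (U w * V w) = \int[P]_w U w * \int[P]_w V w.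
Proof.
move=> iU iV.
pose f (z : measurableTypeR R * measurableTypeR R) := (z.1 * z.2)%:E.
have mf : measurable_fun setT f.
  by apply/measurable_EFinP; exact: measurable_funM.
have mfW : measurable_fun setT (f \o W) by exact: measurableT_comp.
have mE : measurable_fun [set: measurableTypeR R] (fun y : R => y%:E).
  exact/measurable_EFinP/measurable_id.
have mabs : measurable_fun [set: measurableTypeR R] (fun y : R => `|y%:E|%E).
  exact: measurableT_comp.
have idZ (Z : {mfun T >-> measurableTypeR R}) : P.-integrable setT (EFin \o Z) ->
    (distribution P Z).-integrable setT (fun y => y%:E) /\
    (\int[distribution P Z]_y y%:E = \int[P]_w (Z w)%:E)%E.
  move=> iZ; split; last by rewrite integral_distribution.
  apply/integrableP; split => //.
  rewrite ge0_integral_distribution//.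
  by case/integrableP : iZ.
have [iU' EU] := idZ U iU; have [iV' EV] := idZ V iV.
have nU := integrable_lty measurableT (integrable_abse iU').
have nV := integrable_lty measurableT (integrable_abse iV').
have inner x : (\int[distribution P V]_y f (x, y) =
    x%:E * \int[distribution P V]_y y%:E)%E.
  by rewrite -integralZl//; apply: eq_integral => y _; rewrite /f EFinM.
have iff : (distribution P U \x distribution P V)%E.-integrable setT f.
  apply/integrable12ltyP => //.
  have inner' x : (\int[distribution P V]_y `|f (x, y)| =
      `|x%:E| * \int[distribution P V]_y `|y%:E|)%E.
    rewrite -ge0_integralZl//.
    by apply: eq_integral => y _; rewrite /f EFinM abseM.
  under eq_integral do rewrite inner'.
  rewrite ge0_integralZr//; last exact: integral_ge0.
  by rewrite lte_mul_pinfty// ?integral_ge0// ge0_fin_numE// integral_ge0.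
have ifW : P.-integrable setT (f \o W).
  apply/integrableP; split => //.
  rewrite -(@ge0_integral_distribution _ _ _ _ _ P W (abse \o f))//; last 2 first.
  - exact: measurableT_comp.
  - by move=> y; exact: abse_ge0.
  rewrite -(@eq_measure_integral _ _ _ _ (distribution P W)
    (distribution P U \x distribution P V)%E); last by move=> A mA _; exact: lawE.
  by case/integrableP : iff.
split; first exact: ifW.
rewrite /Rintegral -fineM; last 2 first.
- by rewrite -EU; exact: integrable_fin_num iU'.
- by rewrite -EV; exact: integrable_fin_num iV'.
congr fine; rewrite -[LHS](@integral_distribution _ _ _ _ _ P W f)//.
rewrite -(@eq_measure_integral _ _ _ _ (distribution P W)
    (distribution P U \x distribution P V)%E); last by move=> A mA _; exact: lawE.
rewrite -(integral12_prod_meas1 iff).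
transitivity (\int[distribution P U]_x (x%:E * \int[distribution P V]_y y%:E))%E.
  by apply: eq_integral => x _; exact: inner.
have finV := integrable_fin_num measurableT iV'.
rewrite -(fineK finV) integralZr// EU fineK//.
by rewrite EV.
Qed.

End independent_product.

Lemma independent_Rintegral (U V : T -> R) :
  measurable_fun setT U -> measurable_fun setT V ->
  (forall A B : set R, measurable A -> measurable B ->
    P (U @^-1` A `&` V @^-1` B) = (P (U @^-1` A) * P (V @^-1` B))%E) ->
  P.-integrable setT (EFin \o U) -> P.-integrable setT (EFin \o V) ->
  P.-integrable setT (EFin \o (fun w => U w * V w)) /\
  \int[P]_w (U w * V w) = \int[P]_w U w * \int[P]_w V w.
Proof.
move=> mU mV UV.
have mU' : measurable_fun setT (U : T -> measurableTypeR R) by exact: mU.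
have mV' : measurable_fun setT (V : T -> measurableTypeR R) by exact: mV.
exact: (@independent_integrableM (mfunR mU') (mfunR mV') UV).
Qed.

Lemma integral_normal_law (V : T -> R) (s : R) : 0 < s -> measurable_fun setT V ->
  (forall A, measurable A -> P (V @^-1` A) = normal_prob 0 s A) ->
  [/\ L2 P setT V, P.-integrable setT (EFin \o V), \int[P]_w V w = 0 &
   \int[P]_w V w ^+ 2 = s ^+ 2].
Proof.
move=> s0 mV law.
have mV' : measurable_fun setT (V : T -> measurableTypeR R) by exact: mV.
pose V' : {mfun T >-> measurableTypeR R} := mfunR mV'.
have m2 : measurable_fun [set: measurableTypeR R] (fun x : R => (x ^+ 2)%:E).
  by apply/measurable_EFinP; exact: exprn_measurable.
have E2 : (\int[P]_w (V w ^+ 2)%:E = (s ^+ 2)%:E)%E.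
  rewrite -(normal_prob_second_moment s0).
  rewrite -(@eq_measure_integral _ _ _ _ (normal_prob 0 s) (distribution P V')); last first.
    by move=> A mA _; exact: law.
  by rewrite ge0_integral_distribution// => x; rewrite lee_fin sqr_ge0.
have LV : L2 P setT V.
  split=> //; apply/integrableP; split.
    by apply/measurable_EFinP; exact: measurable_funX.
  under eq_integral do rewrite abse_EFin ger0_norm ?sqr_ge0//.
  by rewrite E2 ltry.
have iV := L2_integrable LV.
split => //; last by rewrite /Rintegral E2.
have [_ E1] := normal_prob_first_moment s0.
rewrite /Rintegral -[0]/(fine 0%E) -E1; congr fine.
rewrite -(@eq_measure_integral _ _ _ _ (normal_prob 0 s) (distribution P V')); last first.
  by move=> A mA _; exact: law.
rewrite integral_distribution//; exact/measurable_EFinP/measurable_id.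
Qed.

End independence.

(** * Brownian increments *)

Section sub_sigma_algebra.
Context (disp : measure_display) (T : measurableType disp) (R : realType).
Implicit Types (G : set (set T)) (f g : T -> R).

Definition sub_measurable G f :=
  forall A : set R, measurable A -> <<s G >> (f @^-1` A).

(** Reading [sub_measurable] as ordinary measurability on [T] with the generated sigma-algebra gives
    the closure under algebraic operations below. *)
Lemma sub_measurableP G f : sub_measurable G f <->
  measurable_fun setT (f : g_sigma_algebraType G -> R).
Proof.
split=> [h _ A mA|h A mA]; first by rewrite setTI; exact: h.
by rewrite -[X in _ X]setTI; exact: (h measurableT A mA).
Qed.

Lemma sub_measurableB G f g : sub_measurable G f -> sub_measurable G g ->
  sub_measurable G (fun w => f w - g w).
Proof.
by move=> /sub_measurableP mf /sub_measurableP mg; apply/sub_measurableP;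
  exact: measurable_funB.
Qed.

Lemma sub_measurableM G f g : sub_measurable G f -> sub_measurable G g ->
  sub_measurable G (fun w => f w * g w).
Proof.
by move=> /sub_measurableP mf /sub_measurableP mg; apply/sub_measurableP;
  exact: measurable_funM.
Qed.

Lemma sub_measurableX G f n : sub_measurable G f ->
  sub_measurable G (fun w => f w ^+ n).
Proof.
by move=> /sub_measurableP mf; apply/sub_measurableP; exact: measurable_funX.
Qed.

Lemma sub_measurable_le G G' f : G `<=` G' -> sub_measurable G f ->
  sub_measurable G' f.
Proof. by move=> GG' h A mA; exact: (sub_sigma_algebra2 GG') (h A mA). Qed.

Lemma sub_measurable_measurable G f : G `<=` measurable -> sub_measurable G f ->
  measurable_fun setT f.
Proof.
move=> Gm h _ A mA; rewrite setTI.
have : <<s G >> `<=` @measurable _ T.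
  by apply: smallest_sub => //; exact: sigma_algebra_measurable.
by apply; exact: h.
Qed.

Lemma sub_measurable_path (Y : R -> T -> R) (D : set R) s :
  D s -> sub_measurable (path_events measurable Y D) (Y s).
Proof.
move=> Ds A mA; apply: sub_sigma_algebra; exists s => //.
by exists A => //; rewrite setTI.
Qed.

(** Pi-lambda argument: the measurable sets independent of [D] form a Dynkin system, and [K] is
    stable under intersection. *)
Lemma independent_generated (P : probability T R) (K : set (set T)) (D : set T) :
  setI_closed K -> K `<=` measurable -> measurable D ->
  (forall E, K E -> P (D `&` E) = (P D * P E)%E) ->
  forall E, <<s K >> E -> P (D `&` E) = (P D * P E)%E.
Proof.
move=> KI Km mD DK.
suff : <<s K >> `<=` [set E | measurable E /\ P (D `&` E) = (P D * P E)%E].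
  by move=> h E /h[].
apply: lambda_system_subset; [by []| | |by []]; last first.
  by move=> E KE; split; [exact: Km|exact: DK].
apply/dynkin_lambda_system; split.
- by split=> //; rewrite setIT probability_setT mule1.
- move=> S [mS DS]; split; first exact: measurableC.
  rewrite -setDE probability_setC//.
  rewrite measureD//; last exact: le_lt_trans (probability_le1 P mD) (ltry _).
  rewrite [X in (_ - X)%E]DS muleBr ?mule1//; first exact: fin_num_measure.
- move=> F tF DF; have mF n : measurable (F n) by case: (DF n).
  split; first exact: bigcupT_measurable.
  rewrite setI_bigcupr measure_bigcup//; last 2 first.
  - by move=> n _; exact: measurableI.
  - exact: trivIset_setIl.
  have DE : P D = (fine (P D))%:E by rewrite fineK// fin_num_measure.
  rewrite measure_bigcup// DE -nneseriesZl//.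
  by apply: eq_eseriesr => n _; rewrite -DE; case: (DF n).
Qed.

End sub_sigma_algebra.

Section brownian_increments.
Context (disp : measure_display) (T : measurableType disp) (R : realType).
Context (P : probability T R) (d : nat).
Variables (X : R -> T -> 'I_d) (B : R -> {RV P >-> R}).
Hypothesis mX : forall (t : R) i, 0 <= t -> measurable (X t @^-1` [set i]).
Hypothesis hB : is_brownian_motion B.
Hypothesis hXB : independent_processes X B.

Implicit Types s u : R.
Local Notation incr s u := (fun w : T => (B u w - B s w)%R).
Local Notation EX := (path_events [set: set 'I_d] X).
Local Notation EB := (path_events measurable B).

(* The chain is adjoined up to time infinity: increments of B remain
   independent of this larger past, which makes the Ito integral orthogonal to
   every square integrable function of the chain. *)
Definition enlarged_past (s : R) : set (set T) := EX `[0, +oo[ `|` EB `[0, s].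

Lemma EX_measurable : EX `[0, +oo[ `<=` measurable.
Proof.
move=> A [s /=]; rewrite in_itv/= andbT => s0 [C _ <-].
rewrite setTI (_ : _ @^-1` _ = \bigcup_(i in C) (X s @^-1` [set i])); last first.
  by apply/seteqP; split=> [w /= Cw|w [i Ci /= ->]]//; exists (X s w).
apply: fin_bigcup_measurable => // i _; exact: mX.
Qed.

Lemma EB_measurable D : EB D `<=` measurable.
Proof. by move=> _ [s _ [C mC <-]]; rewrite setTI; exact: measurable_funPTI. Qed.

Lemma enlarged_past_measurable s : enlarged_past s `<=` measurable.
Proof. by rewrite subUset; split; [exact: EX_measurable|exact: EB_measurable]. Qed.

Lemma path_events_sub (E : Type) (S : set (set E)) (Y : R -> T -> E) D D' :
  D `<=` D' -> path_events S Y D `<=` path_events S Y D'.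
Proof. by move=> DD' A [s Ds h]; exists s => //; exact: DD'. Qed.

Lemma enlarged_past_le s s' : s <= s' -> enlarged_past s `<=` enlarged_past s'.
Proof.
move=> ss'; apply: setUS; apply: path_events_sub.
by apply: subset_itvl; rewrite bnd_simp.
Qed.

Let sub_meas G : G `<=` @measurable _ T -> <<s G >> `<=` @measurable _ T.
Proof. by move=> Gm; apply: smallest_sub => //; exact: sigma_algebra_measurable. Qed.

(** The sets [F]&[G] with [F] an event of the chain and [G] an event of [B] up to [s] form a
    generating pi-system. For them, independence of [X] and [B] first splits off [F], since [D] and
    [G] are both events of [B]; then the Brownian property separates [D] from [G]. *)
Lemma increment_independent s u : 0 <= s <= u ->
  forall A E, measurable A -> <<s enlarged_past s >> E ->
  P (incr s u @^-1` A `&` E) = (P (incr s u @^-1` A) * P E)%E.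
Proof.
move=> /andP[s0 su] A E mA HE; case: hB => _ _ hind _.
set D := _ @^-1` A.
have mDel : measurable_fun setT (fun w => B u w - B s w) by exact: measurable_funB.
have mD : measurable D by rewrite -[X in measurable X]setTI; exact: mDel.
have u0 : 0 <= u by exact: le_trans su.
pose K := [set E | exists F G, [/\ <<s EX `[0, +oo[ >> F, <<s EB `[0, s] >> G
  & E = F `&` G]].
have sub0 : EB `[0, s] `<=` EB `[0, +oo[.
  by apply: path_events_sub; apply: subset_itvl.
have DB : <<s EB `[0, +oo[ >> D.
  have h : sub_measurable (EB `[0, +oo[) (fun w => B u w - B s w).
    by apply: sub_measurableB; apply: sub_measurable_path; rewrite /= in_itv/= andbT.
  exact: h.
have DG G : <<s EB `[0, s] >> G -> P (D `&` G) = (P D * P G)%E.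
  move=> GG; apply: (hind s u) => //; first by rewrite s0.
  by exists A => //; rewrite setTI.
apply: (@independent_generated _ _ _ P K) => //.
- move=> _ _ [F [G [hF hG ->]]] [F' [G' [hF' hG' ->]]].
  exists (F `&` F'), (G `&` G'); split; last by rewrite setIACA.
    exact: (@measurableI _ (g_sigma_algebraType (EX `[0, +oo[))).
  exact: (@measurableI _ (g_sigma_algebraType (EB `[0, s]))).
- move=> _ [F [G [hF hG ->]]]; apply: measurableI.
    exact: (sub_meas EX_measurable).
  exact: (@sub_meas (EB `[0, s]) (@EB_measurable _) G hG).
- move=> _ [F [G [hF hG ->]]].
  have hG' : <<s EB `[0, +oo[ >> G by exact: (sub_sigma_algebra2 sub0).
  have DGB : <<s EB `[0, +oo[ >> (D `&` G).
    exact: (@measurableI _ (g_sigma_algebraType (EB `[0, +oo[))).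
  rewrite (_ : D `&` (F `&` G) = F `&` (D `&` G)); last by rewrite setICA.
  by rewrite (hXB hF DGB) DG// (hXB hF hG') muleCA.
- move: HE; apply: sub_sigma_algebra2 => C [CX|CB].
    exists C, setT; split; [exact: sub_sigma_algebra| |by rewrite setIT].
    exact: (@measurableT _ (g_sigma_algebraType (EB `[0, s]))).
  exists setT, C; split; [|exact: sub_sigma_algebra|by rewrite setTI].
  exact: (@measurableT _ (g_sigma_algebraType (EX `[0, +oo[))).
Qed.

Lemma increment_moments s u : 0 <= s <= u ->
  [/\ L2 P setT (fun w => B u w - B s w), \int[P]_w (B u w - B s w) = 0 &
   \int[P]_w (B u w - B s w) ^+ 2 = u - s].
Proof.
(* The case [s = u] is apart: the Gaussian law of the increment is given only for [s < u]. *)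
move=> /andP[s0]; rewrite le_eqVlt => /predU1P[<-|su].
  have -> : (fun w => B s w - B s w) = (fun=> 0).
    by apply/funext => w; rewrite subrr.
  split.
  - by apply: (@L2_prob_bounded _ _ _ _ _ 0) => // w; rewrite normr0.
  - by rewrite /Rintegral integral0.
  - under eq_Rintegral do rewrite subrr expr0n/=.
    by rewrite subrr /Rintegral integral0.
case: hB => _ _ _ law.
have sq0 : 0 < Num.sqrt (u - s) by rewrite sqrtr_gt0 subr_gt0.
have mDel : measurable_fun setT (fun w => B u w - B s w) by exact: measurable_funB.
have [|L _ E1 E2] := @integral_normal_law _ _ _ P _ _ sq0 mDel.
  by move=> A mA; apply: law => //; rewrite s0.
by split => //; rewrite E2 sqr_sqrtr// subr_ge0 ltW.
Qed.

Lemma increment_orthogonal s u (Z : T -> R) : 0 <= s <= u ->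
  sub_measurable (enlarged_past s) Z -> L2 P setT Z ->
  \int[P]_w (Z w * (B u w - B s w)) = 0.
Proof.
move=> su hZ LZ; have [L E1 _] := increment_moments su.
have [|_ ->] := @independent_Rintegral _ _ _ P Z (fun w => B u w - B s w) LZ.1 L.1 _
  (L2_integrable LZ) (L2_integrable L); last by rewrite E1 mulr0.
move=> A A' mA mA'; rewrite setIC (increment_independent su mA')//; last exact: hZ.
by rewrite muleC.
Qed.

(** Independence is applied to the squares of [Z] and of the increment: it factorizes the
    expectation and at the same time yields the integrability of the product. *)
Lemma increment_square s u (Z : T -> R) : 0 <= s <= u ->
  sub_measurable (enlarged_past s) Z -> L2 P setT Z ->
  L2 P setT (fun w => Z w * (B u w - B s w)) /\
  \int[P]_w (Z w * (B u w - B s w)) ^+ 2 = \int[P]_w Z w ^+ 2 * (u - s).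
Proof.
move=> su hZ LZ; have [L _ E2] := increment_moments su.
have [|||||] := @independent_Rintegral _ _ _ P (fun w => Z w ^+ 2)
   (fun w => (B u w - B s w) ^+ 2).
- by apply: measurable_funX; exact: LZ.1.
- by apply: measurable_funX; exact: L.1.
- move=> A A' mA mA'.
  have mA'' : measurable ((fun x : R => x ^+ 2) @^-1` A').
    by rewrite -[X in measurable X]setTI; exact: exprn_measurable.
  rewrite setIC (increment_independent su mA'')//; last exact: sub_measurableX.
  by rewrite muleC.
- exact: LZ.2.
- exact: L.2.
rewrite E2 => i2 <-; split; last by apply: eq_Rintegral => w _; rewrite exprMn.
split; first by apply: measurable_funM; [exact: LZ.1|exact: L.1].
by apply: eq_integrable i2 => // w _ /=; rewrite exprMn.
Qed.

End brownian_increments.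

Section Rintegral_sum.
Context (d : measure_display) (T : measurableType d) (R : realType).
Variables (mu : {measure set T -> \bar R}) (D : set T).
Hypothesis mD : measurable D.

Lemma integrable_sum_EFin (n : nat) (f : 'I_n -> T -> R) :
  (forall k, mu.-integrable D (EFin \o f k)) ->
  mu.-integrable D (EFin \o (fun x => \sum_(k < n) f k x)).
Proof.
elim: n f => [|n ih] f hf.
  have -> : EFin \o (fun x => \sum_(k < 0) f k x) = cst 0%E.
    by apply/funext => x /=; rewrite big_ord0.
  exact: integrable0.
have -> : (fun x => \sum_(k < n.+1) f k x) =
    (fun x => \sum_(k < n) f (widen_ord (leqnSn n) k) x + f ord_max x).
  by apply/funext => x; rewrite big_ord_recr.
by apply: integrableD_EFin => //; exact: ih.
Qed.

Lemma Rintegral_sum (n : nat) (f : 'I_n -> T -> R) :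
  (forall k, mu.-integrable D (EFin \o f k)) ->
  \int[mu]_(x in D) (\sum_(k < n) f k x) = \sum_(k < n) \int[mu]_(x in D) f k x.
Proof.
elim: n f => [|n ih] f hf.
  under eq_Rintegral do rewrite big_ord0.
  by rewrite big_ord0 /Rintegral integral0.
under eq_Rintegral do rewrite big_ord_recr /=.
rewrite big_ord_recr /= RintegralD//; last exact: integrable_sum_EFin.
by rewrite ih.
Qed.

End Rintegral_sum.

(** * Moments of the Ito integral *)

Section simple_integrals.
Context (disp : measure_display) (T : measurableType disp) (R : realType).
Context (P : probability T R) (d : nat).
Variables (X : R -> T -> 'I_d) (B : R -> {RV P >-> R}).
Hypothesis mX : forall (t : R) i, 0 <= t -> measurable (X t @^-1` [set i]).
Hypothesis hB : is_brownian_motion B.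
Hypothesis hXB : independent_processes X B.
Variable S : simple_process (joint_filtration X B).
Implicit Types (r : R) (k l : nat).

Local Notation tm := (sp_time S).
Local Notation xi := (sp_coef S).
Local Notation past := (enlarged_past X B).
Let mint k r := Num.min (tm k) r.
(** Either [r <= tm k] and the summand vanishes, or its left endpoint is [tm k] itself, the time at
    which [xi k] is known. The moment computations below split into these two cases. *)
Let term k r w := xi k w * (B (mint k.+1 r) w - B (mint k r) w).

Let tm0 k : 0 <= tm k.
Proof. by apply: le_trans (sp_time_ge0 S) _; exact: (sp_time_homo S). Qed.

Let tmS k : tm k <= tm k.+1.
Proof. exact: (sp_time_homo S). Qed.

Let mint0 k r : 0 <= r -> 0 <= mint k r.
Proof. by move=> r0; rewrite le_min tm0. Qed.

Let mintS k r : mint k r <= mint k.+1 r.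
Proof. by rewrite le_min ge_min tmS /= ge_min lexx orbT. Qed.

Let xi_past k : sub_measurable (past (tm k)) (xi k).
Proof.
move=> A mA; have := sp_coef_adapted S k mA.
apply: sub_sigma_algebra2; apply: setSU; apply: path_events_sub.
exact: subset_itvl.
Qed.

Let mxi k : measurable_fun setT (xi k).
Proof.
by apply: sub_measurable_measurable (@xi_past k); exact: enlarged_past_measurable.
Qed.

Let Lxi k : L2 P setT (xi k).
Proof. by have [C hC] := sp_coef_bounded S k; exact: (@L2_prob_bounded _ _ _ _ _ C). Qed.

Let L2_xi k (Z : T -> R) : L2 P setT Z -> L2 P setT (fun w => Z w * xi k w).
Proof.
move=> LZ; have [C hC] := sp_coef_bounded S k.
apply: (L2_le measurableT _ (L2Z measurableT C LZ)).
  by apply: measurable_funM => //; exact: LZ.1.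
move=> w _; rewrite !normrM mulrC ler_wpM2r//.
exact: le_trans (hC w) (ler_norm _).
Qed.

Let B_past u v : 0 <= u -> u <= v -> sub_measurable (past v) (B u).
Proof.
move=> u0 uv; apply: (@sub_measurable_le _ _ _ (path_events measurable B `[0, v])).
  by move=> A h; right.
by apply: (@sub_measurable_path _ _ _ (fun s => B s)); rewrite /= in_itv/= u0.
Qed.

Let past_le u v (Z : T -> R) : u <= v -> sub_measurable (past u) Z ->
  sub_measurable (past v) Z.
Proof. by move=> uv; apply: sub_measurable_le; exact: enlarged_past_le. Qed.

Let term_late k r w : r <= tm k -> term k r w = 0.
Proof.
move=> rk; rewrite /term /mint !min_r ?subrr ?mulr0//.
exact: le_trans rk (tmS k).
Qed.

Let mint_early k r : tm k < r -> mint k r = tm k.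
Proof. by move=> kr; rewrite /mint min_l// ltW. Qed.

Let term_square k r : 0 <= r -> L2 P setT (term k r) /\
  \int[P]_w term k r w ^+ 2 = \int[P]_w xi k w ^+ 2 * (mint k.+1 r - mint k r).
Proof.
move=> r0; have [rk|kr] := leP r (tm k).
  have -> : term k r = fun=> 0 by apply/funext => w; rewrite term_late.
  split; first by apply: (@L2_prob_bounded _ _ _ _ _ 0) => // w; rewrite normr0.
  rewrite /mint !min_r ?subrr ?mulr0//; last exact: le_trans rk (tmS k).
  under eq_Rintegral do rewrite expr0n /=.
  by rewrite /Rintegral integral0.
rewrite /term (mint_early kr); apply: (increment_square mX hB hXB) => //.
by rewrite tm0 -(mint_early kr) mintS.
Qed.

Let term_orthogonal k r (Z : T -> R) : 0 <= r ->
  sub_measurable (past (tm k)) Z -> L2 P setT Z ->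
  \int[P]_w (Z w * term k r w) = 0.
Proof.
move=> r0 hZ LZ; have [rk|kr] := leP r (tm k).
  under eq_Rintegral do rewrite term_late// mulr0.
  by rewrite /Rintegral integral0.
under eq_Rintegral do rewrite /term mulrA (mint_early kr).
apply: (increment_orthogonal mX hB hXB); last exact: L2_xi.
- by rewrite tm0 -(mint_early kr) mintS.
- exact: sub_measurableM.
Qed.

Let term_past k r v : 0 <= r -> tm k <= v -> mint k.+1 r <= v ->
  sub_measurable (past v) (term k r).
Proof.
move=> r0 kv mv; apply: sub_measurableM; first exact: past_le (@xi_past k).
apply: sub_measurableB; apply: B_past => //; [exact: mint0|exact: mint0|].
exact: le_trans (mintS k r) mv.
Qed.

(** The increment up to [r'] is cut at [mint k.+1 r]. The later piece, weighted by [xi k], is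
    orthogonal to [term k r], which is known by then; only the square of [term k r] remains. *)
Let term_diag k r r' : 0 <= r <= r' ->
  \int[P]_w (term k r w * term k r' w) =
  \int[P]_w xi k w ^+ 2 * (mint k.+1 r - mint k r).
Proof.
move=> /andP[r0 rr']; have [rk|kr] := leP r (tm k).
  under eq_Rintegral do rewrite term_late// mul0r.
  rewrite /mint !min_r ?subrr ?mulr0//; last exact: le_trans rk (tmS k).
  by rewrite /Rintegral integral0.
have kr' := lt_le_trans kr rr'.
have [Lt Et] := term_square k r0.
pose del w := B (mint k.+1 r') w - B (mint k.+1 r) w.
have km : tm k <= mint k.+1 r by rewrite -(mint_early kr) mintS.
have mm : 0 <= mint k.+1 r <= mint k.+1 r'.
  by rewrite mint0//= /mint le_min !ge_min lexx rr' orbT.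
have hZ : sub_measurable (past (mint k.+1 r)) (fun w => term k r w * xi k w).
  apply: sub_measurableM; last exact: past_le (@xi_past k).
  exact: term_past.
have LZ := L2_xi k Lt.
have O := increment_orthogonal mX hB hXB mm hZ LZ.
have [Ldel _] := increment_square mX hB hXB mm (past_le km (@xi_past k)) (Lxi k).
rewrite -Et -[RHS]addr0 -[X in _ = _ + X]O -RintegralD//; last 2 first.
- exact: Lt.2.
- have := L2_integrableM measurableT Lt Ldel; congr integrable.
  by apply/funext => w /=; rewrite mulrA.
by apply: eq_Rintegral => w _; rewrite /term (mint_early kr) (mint_early kr'); ring.
Qed.

Lemma sp_integral_L2 r : 0 <= r -> L2 P setT (sp_integral S B r).
Proof.
move=> r0.
have -> : sp_integral S B r = (fun w => \sum_(k < sp_size S) term k r w) by [].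
by apply: L2_sum => // k; have [] := term_square k r0.
Qed.

(** For [k != l], the summand with the smaller index is known when the other starts, whatever the
    two horizons, so only the diagonal survives. The value depends on the smaller horizon alone. *)
Lemma sp_integral_covariance r r' : 0 <= r <= r' ->
  \int[P]_w (sp_integral S B r w * sp_integral S B r' w) =
  \sum_(k < sp_size S) \int[P]_w xi k w ^+ 2 *
    (Num.min (tm k.+1) r - Num.min (tm k) r).
Proof.
move=> /andP[r0 rr']; have r'0 := le_trans r0 rr'.
have Lt k s : 0 <= s -> L2 P setT (term k s).
  by move=> s0; have [] := term_square k s0.
transitivity (\int[P]_w (\sum_(k < sp_size S) \sum_(l < sp_size S)
    (term k r w * term l r' w))).
  apply: eq_Rintegral => w _; rewrite /sp_integral big_distrl /=.
  by apply: eq_bigr => k _; rewrite big_distrr.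
have itt k l : P.-integrable setT (EFin \o (fun w => term k r w * term l r' w)).
  by apply: L2_integrableM => //; exact: Lt.
rewrite Rintegral_sum//; last by move=> k; exact: integrable_sum_EFin.
apply: eq_bigr => k _; rewrite Rintegral_sum//.
rewrite (bigD1 k)//= term_diag ?r0// big1 ?addr0// => l lk.
have [kl|kl] := ltnP k l.
  apply: term_orthogonal => //; last exact: Lt.
  apply: term_past => //; first exact: (sp_time_homo S (ltnW kl)).
  by rewrite /mint ge_min (sp_time_homo S kl).
have {}kl : (l < k)%N by rewrite ltn_neqAle kl andbT.
under eq_Rintegral do rewrite mulrC.
apply: term_orthogonal => //; last exact: Lt.
apply: term_past => //; first exact: (sp_time_homo S (ltnW kl)).
by rewrite /mint ge_min (sp_time_homo S kl).
Qed.

(** [Z] belongs to the past at every [tm k], and multiplying it by the bounded coefficient keeps it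
    in L^2, so each increment is orthogonal to [Z * xi k]. *)
Lemma sp_integral_orthogonal r (Z : T -> R) : 0 <= r ->
  (forall s, sub_measurable (past s) Z) -> L2 P setT Z ->
  \int[P]_w (Z w * sp_integral S B r w) = 0.
Proof.
move=> r0 hZ LZ.
transitivity (\int[P]_w (\sum_(k < sp_size S) Z w * term k r w)).
  by apply: eq_Rintegral => w _; rewrite /sp_integral big_distrr.
rewrite Rintegral_sum//; last first.
  by move=> k; apply: L2_integrableM => //; have [] := term_square k r0.
by rewrite big1// => k _; exact: term_orthogonal.
Qed.

(** The half-open intervals are disjoint, so the cross products vanish. *)
Lemma sp_val_square s w : sp_val S s w ^+ 2 =
  \sum_(k < sp_size S) xi k w ^+ 2 * \1_(`]tm k, tm k.+1]) s.
Proof.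
rewrite /sp_val expr2 big_distrl /=; apply: eq_bigr => k _.
rewrite big_distrr /= (bigD1 k)//= big1 ?addr0; last first.
  move=> l lk; rewrite !indicE !mem_setE !in_itv/=.
  have [/andP[k1 k2]|_] := boolP (tm k < s <= tm k.+1); last by rewrite mulr0 mul0r.
  have [/andP[l1 l2]|_] := boolP (tm l < s <= tm l.+1); last by rewrite !mulr0.
  have [kl|kl] := ltnP k l.
    by have := le_lt_trans (sp_time_homo S kl) l1; rewrite ltNge k2.
  have {}kl : (l < k)%N by rewrite ltn_neqAle kl andbT.
  by have := le_lt_trans (sp_time_homo S kl) k1; rewrite ltNge l2.
by rewrite !indicE; case: (_ \in _); rewrite ?mulr1 ?mulr0 ?mul0r// expr2.
Qed.

Lemma integral_sp_val_square r w : 0 <= r ->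
  (\int[lebesgue_measure]_(s in `[0%R, r]) (sp_val S s w ^+ 2)%:E =
  (\sum_(k < sp_size S) xi k w ^+ 2 *
    (Num.min (tm k.+1) r - Num.min (tm k) r))%:E)%E.
Proof.
move=> r0; under eq_integral do rewrite sp_val_square -sumEFin.
have mI k : measurable_fun `[0, r] (fun s : measurableTypeR R =>
    (\1_(`]tm k, tm k.+1]) s : R)%:E).
  by apply/measurable_EFinP/measurable_funTS; exact: measurable_indic.
rewrite ge0_integral_sum//; last 2 first.
- by move=> k; apply/measurable_EFinP/measurable_funM => //; exact/measurable_EFinP.
- by move=> k s _; rewrite lee_fin mulr_ge0// sqr_ge0.
rewrite -sumEFin; apply: eq_bigr => k _.
under eq_integral do rewrite EFinM.
rewrite ge0_integralZl_EFin ?sqr_ge0//; last exact: mI.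
rewrite [RHS]EFinM; congr (_ * _)%E; rewrite integral_indic//=.
rewrite (_ : _ `&` _ = `]tm k, Num.min (tm k.+1) r]%classic); last first.
  apply/seteqP; split => s /=; rewrite !in_itv/= le_min.
    by move=> [/andP[-> ->] /andP[_ ->]].
  by move=> /andP[ks /andP[-> ->]]; rewrite ks (ltW (le_lt_trans (tm0 k) ks)).
rewrite lebesgue_measure_itv /= lte_fin lt_min.
have := tmS k; rewrite le_eqVlt => /predU1P[<-|kk].
  by rewrite ltxx /= subrr.
rewrite kk /=; have [kr|rk] := ltP (tm k) r; first by rewrite EFinB.
by rewrite min_r ?subrr// ltW// (le_lt_trans rk).
Qed.

(** The right-hand side is that of [sp_integral_covariance]: together the two lemmas are the Ito
    isometry for simple processes. *)
Lemma expectation_sp_val_square r : 0 <= r ->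
  (\int[P]_w \int[lebesgue_measure]_(s in `[0%R, r]) (sp_val S s w ^+ 2)%:E =
  (\sum_(k < sp_size S) \int[P]_w xi k w ^+ 2 *
    (Num.min (tm k.+1) r - Num.min (tm k) r))%:E)%E.
Proof.
move=> r0; under eq_integral do rewrite integral_sp_val_square//.
have ik (k : 'I_(sp_size S)) : P.-integrable setT
    (EFin \o (fun w => xi k w ^+ 2 * (Num.min (tm k.+1) r - Num.min (tm k) r))).
  have := integrableZl_EFin measurableT (Num.min (tm k.+1) r - Num.min (tm k) r)
    (Lxi k).2.
  by congr integrable; apply/funext => w /=; rewrite mulrC.
rewrite -[LHS]fineK; last first.
  apply: (integrable_fin_num measurableT).
  exact: (integrable_sum_EFin measurableT ik).
rewrite -/(Rintegral _ _ _) Rintegral_sum//; congr EFin.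
apply: eq_bigr => k _; rewrite RintegralZr//; exact: (Lxi k).2.
Qed.

Lemma sp_val_measurable :
  measurable_fun setT (fun z : T * measurableTypeR R => sp_val S z.2 z.1).
Proof.
apply: measurable_sum => k; apply: measurable_funM.
  exact: (measurableT_comp (@mxi k) measurable_fst).
apply: (measurableT_comp _ measurable_snd).
exact: measurable_indic.
Qed.

End simple_integrals.

(** * Tonelli on the product of the probability space and a time interval *)

Section time_product.
Context (disp : measure_display) (T : measurableType disp) (R : realType).
Variable P : probability T R.
Local Notation mu := (@lebesgue_measure R).

Section ge0.
Variables (f : T * measurableTypeR R -> R) (r : R).
Hypotheses (mf : measurable_fun setT f) (f0 : forall z, 0 <= f z).

Let g (z : T * measurableTypeR R) : \bar R := (f z * \1_(`[0, r]%classic) z.2)%:E.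

Let mg : measurable_fun setT g.
Proof.
apply/measurable_EFinP; apply: measurable_funM => //.
apply: (measurableT_comp _ measurable_snd); exact: measurable_indic.
Qed.

Let g0 z : (0 <= g z)%E.
Proof. by rewrite lee_fin mulr_ge0. Qed.

Let gE : (\int[P \x mu]_(z in setT `*` `[0%R, r]) (f z)%:E =
  \int[P \x mu]_z g z)%E.
Proof.
rewrite integral_mkcond; apply: eq_integral => z _.
rewrite patchE /g indicE.
have -> : (z \in [set: T] `*` `[0, r]) = (z.2 \in `[0, r]%classic).
  by apply/idP/idP => /set_mem h; apply/mem_set => //; case: h.
by case: (_ \in _); rewrite ?mulr1 ?mulr0.
Qed.

(** Reads the iterated integral of [is_ito_integral] as one integral over a product space, where the
    L^2 lemmas apply. The swapped order below puts the expectation inside, where stationarity makes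
    it constant in time. *)
Lemma integral_time_product :
  (\int[P \x mu]_(z in setT `*` `[0%R, r]) (f z)%:E =
   \int[P]_w \int[mu]_(s in `[0%R, r]) (f (w, s))%:E)%E.
Proof.
rewrite gE (fubini_tonelli1 g mg g0); apply: eq_integral => w _.
rewrite /fubini_F [RHS]integral_mkcond; apply: eq_integral => s _.
by rewrite patchE /g indicE /=; case: (_ \in _); rewrite ?mulr1 ?mulr0.
Qed.

Lemma integral_time_product_swap :
  (\int[P \x mu]_(z in setT `*` `[0%R, r]) (f z)%:E =
   \int[mu]_(s in `[0%R, r]) \int[P]_w (f (w, s))%:E)%E.
Proof.
rewrite gE (fubini_tonelli2 g mg g0) [RHS]integral_mkcond.
apply: eq_integral => s _; rewrite /fubini_G patchE /g /= indicE.
case: (_ \in _); first by apply: eq_integral => w _; rewrite mulr1.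
by under eq_integral do rewrite mulr0; rewrite integral0.
Qed.

End ge0.

End time_product.

Section ito_moments.
Context (disp : measure_display) (T : measurableType disp) (R : realType).
Context (P : probability T R) (d : nat).
Variables (X : R -> T -> 'I_d) (B : R -> {RV P >-> R}).
Hypothesis mX : forall (t : R) i, 0 <= t -> measurable (X t @^-1` [set i]).
Hypothesis hB : is_brownian_motion B.
Hypothesis hXB : independent_processes X B.
Variables (sigma : 'I_d -> R) (I : R -> {RV P >-> R}) (v : R).
Hypothesis hI :
  is_ito_integral (joint_filtration X B) B (fun s w => sigma (X s w)) I.
Local Notation mu := (@lebesgue_measure R).
Hypothesis mSX : measurable_fun setT
  (fun z : T * measurableTypeR R => sigma (X (Num.max z.2 0) z.1)).
Hypothesis ESX : forall s : R, 0 <= s ->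
  (\int[P]_w (sigma (X s w) ^+ 2)%:E = v%:E)%E.
Implicit Types r s : R.

Lemma ito_L2 r : 0 <= r -> L2 P setT (I r).
Proof.
move=> r0; have [S hS] := hI; have [_ hS2] := hS r r0.
have mI : measurable_fun setT (I r) by [].
by have [] := L2_cvg measurableT mI
  (fun n => sp_integral_L2 mX hB hXB (S n) r0) hS2.
Qed.

(** Each approximating simple integral is orthogonal to [Z], and inner products pass to the limit
    against the constant sequence [Z]. *)
Lemma ito_orthogonal r (Z : T -> R) : 0 <= r ->
  (forall s, sub_measurable (enlarged_past X B s) Z) -> L2 P setT Z ->
  \int[P]_w (Z w * I r w) = 0.
Proof.
move=> r0 hZ LZ; have [S hS] := hI; have [_ hS2] := hS r r0.
have mI : measurable_fun setT (I r) by [].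
have [LI cI] := L2_cvg measurableT mI
  (fun n => sp_integral_L2 mX hB hXB (S n) r0) hS2.
have cZ : (\int[P]_w (Z w - Z w) ^+ 2) @[n --> \oo] --> (0 : R).
  under eq_Rintegral do rewrite subrr expr0n.
  by rewrite /Rintegral integral0; exact: cvg_cst.
have := L2_cvg_inner measurableT LZ LI (fun=> LZ)
  (fun n => sp_integral_L2 mX hB hXB (S n) r0) cZ cI.
under eq_fun do rewrite sp_integral_orthogonal//.
by move=> h; apply: (cvg_unique _ h) => //; exact: cvg_cst.
Qed.

(** [is_ito_integral] provides one approximating sequence for all horizons, so [I r] and [I r'] are
    approximated together. The covariance of the simple integrals is the squared norm of the
    integrand over [[0, r]]; it tends to that of [sigma (X s)], which is [v * r] by [ESX]. *)
Lemma ito_covariance r r' : 0 <= r <= r' ->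
  \int[P]_w (I r w * I r' w) = v * r.
Proof.
move=> rr'; have /andP[r0 rr] := rr'; have r'0 := le_trans r0 rr.
have [S hS] := hI; have [hS1 hS2] := hS r r0; have [_ hS2'] := hS r' r'0.
have mI s : measurable_fun setT (I s) by [].
have LS n s : 0 <= s -> L2 P setT (sp_integral (S n) B s).
  exact: sp_integral_L2.
have [LI cI] := L2_cvg measurableT (mI r) (fun n => LS n r r0) hS2.
have [LI' cI'] := L2_cvg measurableT (mI r') (fun n => LS n r' r'0) hS2'.
have c1 := L2_cvg_inner measurableT LI LI' (fun n => LS n r r0)
  (fun n => LS n r' r'0) cI cI'.
pose D : set (T * measurableTypeR R) := setT `*` `[0, r].
have mD : measurable D by exact: measurableX.
pose f (z : T * measurableTypeR R) := sigma (X (Num.max z.2 0) z.1).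
pose F n (z : T * measurableTypeR R) := sp_val (S n) z.2 z.1.
have mF n : measurable_fun setT (F n) by exact: sp_val_measurable.
have EF n : (\int[P \x mu]_(z in D) (F n z ^+ 2)%:E =
    (\int[P]_w (sp_integral (S n) B r w * sp_integral (S n) B r' w))%:E)%E.
  rewrite (@integral_time_product _ _ _ P (fun z => F n z ^+ 2)); last 2 first.
  - exact: measurable_funX.
  - by move=> z; exact: sqr_ge0.
  by rewrite expectation_sp_val_square// sp_integral_covariance.
have LF n : L2 (P \x mu)%E D (F n).
  split; first exact: measurable_funTS.
  apply/integrableP; split.
    by apply/measurable_EFinP/measurable_funX/measurable_funTS.
  under eq_integral do rewrite abse_EFin ger0_norm ?sqr_ge0//.
  by rewrite EF ltry.
have Ef : (\int[P \x mu]_(z in D) (f z ^+ 2)%:E = (v * r)%:E)%E.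
  rewrite (@integral_time_product_swap _ _ _ P (fun z => f z ^+ 2)); last 2 first.
  - exact: measurable_funX.
  - by move=> z; exact: sqr_ge0.
  transitivity (\int[mu]_(s in `[0%R, r]) (cst v%:E) s)%E.
    apply: eq_integral => s; rewrite mem_setE in_itv/= => /andP[s0 _].
    by rewrite /f /= max_l// ESX.
  rewrite integral_cst//= lebesgue_measure_itv /= lte_fin.
  case: ltP => [_|h]; first by rewrite oppr0 addr0 -EFinM.
  by rewrite mule0 (@le_anti _ _ r 0) ?mulr0// h r0.
have c2 : (\int[P \x mu]_(z in D) ((f z - F n z) ^+ 2)%:E)%E @[n --> \oo] --> 0%E.
  apply: cvg_trans hS1; apply: near_eq_cvg; apply: nearW => n /=.
  rewrite (@integral_time_product _ _ _ P (fun z => (f z - F n z) ^+ 2)); last 2 first.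
  - by apply: measurable_funX; exact: measurable_funB.
  - by move=> z; exact: sqr_ge0.
  apply: eq_integral => w _; apply: eq_integral => s; rewrite mem_setE in_itv/=.
  by move=> /andP[s0 _]; rewrite /f /F max_l// -sqrrN opprB.
have [Lf cf] := L2_cvg mD (measurable_funTS mSX) LF c2.
have := L2_cvg_inner mD Lf Lf LF LF cf cf.
have -> : \int[(P \x mu)%E]_(x in D) (f x * f x) = v * r.
  by rewrite /Rintegral; under eq_integral do rewrite -expr2; rewrite Ef.
have -> : (fun n => \int[(P \x mu)%E]_(x in D) (F n x * F n x)) =
   (fun n => \int[P]_w (sp_integral (S n) B r w * sp_integral (S n) B r' w)).
  apply/funext => n; rewrite /Rintegral; under eq_integral do rewrite -expr2.
  by rewrite EF.
by move=> /(cvg_unique _) /(_ c1) ->.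
Qed.

End ito_moments.

(** * The stationary Markov chain *)

Section matrix_exponential.
Context (R : realType) (d : nat).
Implicit Type Q : 'M[R]_d.

Definition mx_sum_norm Q : R := \sum_i \sum_j `|Q i j|.

Definition exp_entry Q (i j : 'I_d) (k : nat) : R := (Q ^+ k) i j / k`!%:R.

Let K_ge0 Q : 0 <= mx_sum_norm Q.
Proof. by apply: sumr_ge0 => i _; apply: sumr_ge0. Qed.

(** Only row [i] enters the product; the other rows of [mx_sum_norm] are a nonnegative surplus that
    makes the bound uniform in [i] and [j]. *)
Lemma mx_exp_entry_le Q k i j : `|(Q ^+ k) i j| <= mx_sum_norm Q ^+ k.
Proof.
elim: k i j => [|k ih] i j.
  rewrite !expr0 mxE; case: eqP => _ /=; first by rewrite normr1.
  by rewrite normr0.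
have -> : (Q ^+ k.+1) i j = \sum_l Q i l * (Q ^+ k) l j.
  by rewrite exprS -mulmxE mxE.
apply: (le_trans (ler_norm_sum _ _ _)).
have -> : mx_sum_norm Q ^+ k.+1 = (\sum_l `|Q i l|) * mx_sum_norm Q ^+ k +
    (\sum_(m | m != i) \sum_l `|Q m l|) * mx_sum_norm Q ^+ k.
  by rewrite exprS {1}/mx_sum_norm (bigD1 i)//= mulrDl.
rewrite ler_wpDr//.
  by rewrite mulr_ge0 ?exprn_ge0//; apply: sumr_ge0 => l _; apply: sumr_ge0.
rewrite big_distrl /=; apply: ler_sum => l _.
by rewrite normrM ler_wpM2l.
Qed.

Let cvg_le (a : nat -> R) (A C x : R) : 0 <= A -> 0 <= C ->
  (forall k, `|a k| <= A * (C ^+ k / k`!%:R)) -> cvgn (pseries a x).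
Proof.
move=> A0 C0 ha; apply: normed_cvg.
apply: (@series_le_cvg _ _ (fun n => A * exp_coeff (C * `|x|) n)).
- by move=> n /=.
- by move=> n; rewrite mulr_ge0// exp_coeff_ge0// mulr_ge0.
- move=> n /=; rewrite normrM normrX /exp_coeff /= exprMn.
  rewrite (_ : A * _ = A * (C ^+ n / n`!%:R) * `|x| ^+ n); last by ring.
  by rewrite ler_wpM2r// exprn_ge0.
- exact/is_cvg_seriesZ/is_cvg_series_exp_coeff.
Qed.

Let exp_entry_le Q i j k : `|exp_entry Q i j k| <= 1 * (mx_sum_norm Q ^+ k / k`!%:R).
Proof.
rewrite mul1r normrM [X in _ * X]ger0_norm ?invr_ge0//.
by rewrite ler_wpM2r ?invr_ge0// mx_exp_entry_le.
Qed.

(** Termwise differentiation keeps the shape of the bound, with [A * C] in place of [A], so the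
    estimate can be iterated. *)
Let diffs_le (a : nat -> R) (A C : R) : 0 <= A -> 0 <= C ->
  (forall k, `|a k| <= A * (C ^+ k / k`!%:R)) ->
  forall k, `|pseries_diffs a k| <= (A * C) * (C ^+ k / k`!%:R).
Proof.
move=> A0 C0 ha k; rewrite /pseries_diffs normrM ger0_norm//.
rewrite -ler_pdivlMl ?ltr0Sn// (le_trans (ha _))// factS natrM exprS.
rewrite le_eqVlt; apply/orP; left; apply/eqP; field.
by rewrite nat1r !pnatr_eq0 -lt0n fact_gt0.
Qed.

Lemma scale_exprn (v : R) Q k : (v *: Q) ^+ k = v ^+ k *: Q ^+ k.
Proof.
elim: k => [|k ih]; first by rewrite !expr0 scale1r.
by rewrite !exprS ih -!mulmxE -scalemxAl -scalemxAr scalerA.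
Qed.

Lemma transitionE Q v i j :
  transition Q v i j = limn (pseries (exp_entry Q i j) v).
Proof.
rewrite /transition /expmx mxE; congr (limn (series _)); apply/funext => k /=.
by rewrite scale_exprn mxE /exp_entry; ring.
Qed.

Lemma cvg_transition Q v i j :
  pseries (exp_entry Q i j) v @ \oo --> transition Q v i j.
Proof.
rewrite transitionE; exact: (@cvg_le _ _ _ v ler01 (K_ge0 Q) (exp_entry_le Q i j)).
Qed.

(** A power series is differentiable inside a disc on which it and its first two derived series
    converge; at [v] the radius [|v| + 1] is taken. *)
Lemma continuous_transition Q i j : continuous (fun v => transition Q v i j).
Proof.
have -> : (fun v => transition Q v i j) = (fun v => limn (pseries (exp_entry Q i j) v)).
  by apply/funext => v; rewrite transitionE.
move=> v.
have h0 := exp_entry_le Q i j.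
have h1 := diffs_le ler01 (K_ge0 Q) h0.
have A1 : 0 <= 1 * mx_sum_norm Q by rewrite mul1r.
have h2 := diffs_le A1 (K_ge0 Q) h1.
have A2 : 0 <= 1 * mx_sum_norm Q * mx_sum_norm Q by rewrite mulr_ge0.
have dv := @pseries_snd_diffs _ (exp_entry Q i j) (`|v| + 1) v
  (@cvg_le _ _ _ (`|v| + 1) ler01 (K_ge0 Q) h0) (@cvg_le _ _ _ (`|v| + 1) A1 (K_ge0 Q) h1)
  (@cvg_le _ _ _ (`|v| + 1) A2 (K_ge0 Q) h2).
have vv : `|v| < `| `|v| + 1 | by rewrite (ger0_norm (addr_ge0 _ _))// ltrDl.
have {}dv := dv vv.
by apply/differentiable_continuous/derivable1_diffP.
Qed.

(** The row vector [p] annihilates every positive power of [Q], so only the zeroth term of the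
    exponential series contributes. *)
Lemma transition_invariant Q (p : 'I_d -> R) v j :
  (forall j, \sum_i p i * Q i j = 0) -> \sum_i p i * transition Q v i j = p j.
Proof.
move=> pQ.
have c1 : (fun n => \sum_i p i * pseries (exp_entry Q i j) v n) @ \oo -->
    \sum_i p i * transition Q v i j.
  apply: cvg_big => [|i _]; first exact: add_continuous.
  by apply: cvgMr; exact: cvg_transition.
have c2 : (fun n => \sum_i p i * pseries (exp_entry Q i j) v n) @ \oo --> p j.
  (* The empty partial sum is 0; from index 1 on they all equal [p j]. *)
  rewrite -cvg_shiftS /=.
  have E n : \sum_i p i * pseries (exp_entry Q i j) v n.+1 = p j.
    rewrite /pseries /series /=.
    transitivity (\sum_(0 <= k < n.+1) (\sum_i p i * (Q ^+ k) i j) / k`!%:R * v ^+ k).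
      under eq_bigr do rewrite big_distrr.
      rewrite exchange_big /=; apply: eq_bigr => k _.
      rewrite !big_distrl /=; apply: eq_bigr => i _; rewrite /exp_entry; ring.
    have zero k : \sum_i p i * (Q ^+ k.+1) i j = 0.
      have -> : \sum_i p i * (Q ^+ k.+1) i j =
          \sum_l (\sum_i p i * Q i l) * (Q ^+ k) l j.
        under eq_bigr do rewrite exprS -mulmxE mxE big_distrr.
        rewrite exchange_big /=; apply: eq_bigr => l _.
        by rewrite big_distrl; apply: eq_bigr => i _; rewrite mulrA.
      by rewrite big1// => l _; rewrite pQ mul0r.
    rewrite big_nat_recl//; under [X in _ + X]eq_bigr do rewrite zero !mul0r.
    rewrite big1_eq addr0.
    rewrite expr0 fact0 divr1 mulr1 (bigD1 j)//= big1 ?addr0.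
      by rewrite mxE eqxx mulr1.
    by move=> i ij; rewrite mxE (negbTE ij) mulr0.
  under eq_fun do rewrite E.
  exact: cvg_cst.
exact: (cvg_unique _ c1 c2).
Qed.

End matrix_exponential.

Section chain_moments.
Context (disp : measure_display) (T : measurableType disp) (R : realType).
Context (P : probability T R) (d : nat).
Variables (Q : 'M[R]_d) (p : 'I_d -> R) (X : R -> T -> 'I_d).
Hypothesis hX : is_markov_chain P Q X.
Hypothesis hX0 : forall i, P (X 0 @^-1` [set i]) = (p i)%:E.
Hypothesis pQ : forall j, \sum_i p i * Q i j = 0.
Implicit Types (s u v : R) (phi psi : 'I_d -> R).

Let mX u i : 0 <= u -> measurable (X u @^-1` [set i]).
Proof. by case: hX => + _ _; exact. Qed.

Let pairE u v i j : 0 <= u <= v ->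
  P (X u @^-1` [set i] `&` X v @^-1` [set j]) =
  ((transition Q (v - u) i j)%:E * P (X u @^-1` [set i]))%E.
Proof.
(* The Markov property with [n = 0]; beyond index 1 the times are constant, hence nondecreasing. *)
move=> /andP[u0 uv]; case: hX => _ _ /(_ 0%N (fun k => if k is 0%N then u else v)
  (fun k => if k is 0%N then i else j) u0).
rewrite !bigcap_mkord !big_ord_recl !big_ord0 /= !setIT; apply.
by case=> [|k] [|l].
Qed.

Let indic_chain u i w : (\1_(X u @^-1` [set i]) w : R) = (X u w == i)%:R.
Proof.
rewrite indicE; congr ((nat_of_bool _)%:R).
by apply/idP/eqP => [/set_mem//|h]; exact/mem_set.
Qed.

(** Reduces expectations of functions of the chain to finite sums of probabilities. *)
Lemma chain_decomposition phi u w :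
  phi (X u w) = \sum_i phi i * \1_(X u @^-1` [set i]) w.
Proof.
rewrite (bigD1 (X u w))//= indic_chain eqxx mulr1 big1 ?addr0// => i iX.
by rewrite indic_chain eq_sym (negbTE iX) mulr0.
Qed.

Lemma chain_measurable phi u : 0 <= u ->
  measurable_fun setT (fun w => phi (X u w)).
Proof.
move=> u0; under eq_fun do rewrite chain_decomposition.
apply: measurable_sum => i; apply: measurable_funM => //.
by apply: measurable_indic; exact: mX.
Qed.

Lemma chain_bounded phi : exists2 C, 0 <= C & forall u w, `|phi (X u w)| <= C.
Proof.
exists (\sum_i `|phi i|); first exact: sumr_ge0.
by move=> u w; rewrite (bigD1 (X u w))//= lerDl sumr_ge0.
Qed.

Lemma chain_L2 phi u : 0 <= u -> L2 P setT (fun w => phi (X u w)).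
Proof.
move=> u0; have [C _ hC] := chain_bounded phi.
by apply: (@L2_prob_bounded _ _ _ _ _ C) => //; exact: chain_measurable.
Qed.

Lemma chain_jointly_measurable phi :
  measurable_fun setT (fun z : R * T => phi (X (Num.max z.1 0) z.2)).
Proof.
apply: (@right_continuous_jointly_measurable _ _ _ (fun s w => phi (X s w))).
  by move=> s; exact: chain_measurable.
move=> w s s0; apply: (@cvg_trans _ (phi (X s w) @[u --> s^'+])); last exact: cvg_cst.
apply: near_eq_cvg; case: hX => _ /(_ w s s0) + _.
by apply: filterS => u ->.
Qed.

Let iI u v i j : 0 <= u -> 0 <= v -> P.-integrable setT
  (EFin \o (fun w => \1_(X u @^-1` [set i]) w * \1_(X v @^-1` [set j]) w)).
Proof.
move=> u0 v0; apply: L2_integrableM => //; apply: (@L2_prob_bounded _ _ _ _ _ 1).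
- by apply: measurable_indic; exact: mX.
- by move=> w; rewrite indicE; case: (_ \in _); rewrite ?normr1 ?normr0.
- by apply: measurable_indic; exact: mX.
- by move=> w; rewrite indicE; case: (_ \in _); rewrite ?normr1 ?normr0.
Qed.

Let EI u v i j : 0 <= u -> 0 <= v ->
  \int[P]_w (\1_(X u @^-1` [set i]) w * \1_(X v @^-1` [set j]) w) =
  fine (P (X u @^-1` [set i] `&` X v @^-1` [set j])).
Proof.
move=> u0 v0; rewrite /Rintegral.
have mUV : measurable (X u @^-1` [set i] `&` X v @^-1` [set j]).
  by apply: measurableI; exact: mX.
have := integral_indic P measurableT mUV; rewrite setIT => <-.
by congr fine; apply: eq_integral => w _; rewrite indicI.
Qed.

(** Summing over the state at time 0 gives [\sum_j p j * transition Q u j i], and [p] is invariant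
    under the exponential as well. *)
Lemma chain_stationary u i : 0 <= u -> P (X u @^-1` [set i]) = (p i)%:E.
Proof.
move=> u0; rewrite -[LHS]fineK ?fin_num_measure//; last exact: mX.
congr EFin; rewrite -[RHS](transition_invariant u i pQ).
transitivity (\int[P]_w \1_(X u @^-1` [set i]) w : R).
  congr fine; rewrite integral_indic ?setIT//; exact: mX.
transitivity (\int[P]_w (\sum_j \1_(X 0 @^-1` [set j]) w *
    \1_(X u @^-1` [set i]) w : R)).
  apply: eq_Rintegral => w _; rewrite -big_distrl /=.
  have /= := chain_decomposition (fun=> 1) 0 w.
  by under eq_bigr do rewrite mul1r; move=> <-; rewrite mul1r.
rewrite Rintegral_sum//; last by move=> j; exact: iI.
apply: eq_bigr => j _; rewrite EI// pairE ?lexx ?u0//.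
by rewrite hX0 subr0 -EFinM mulrC.
Qed.

Lemma chain_expectation2 phi psi u v : 0 <= u <= v ->
  \int[P]_w (phi (X u w) * psi (X v w)) =
  \sum_i \sum_j phi i * psi j * (p i * transition Q (v - u) i j).
Proof.
move=> /[dup] uv /andP[u0 uv']; have v0 := le_trans u0 uv'.
transitivity (\int[P]_w (\sum_i \sum_j phi i * psi j *
    (\1_(X u @^-1` [set i]) w * \1_(X v @^-1` [set j]) w))).
  apply: eq_Rintegral => w _; rewrite (chain_decomposition phi) (chain_decomposition psi).
  rewrite big_distrl /=; apply: eq_bigr => i _; rewrite big_distrr /=.
  by apply: eq_bigr => j _; ring.
have iI' i j : P.-integrable setT (EFin \o (fun w => phi i * psi j *
    (\1_(X u @^-1` [set i]) w * \1_(X v @^-1` [set j]) w))).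
  by apply: integrableZl_EFin => //; exact: iI.
rewrite Rintegral_sum//; last by move=> i; exact: integrable_sum_EFin.
apply: eq_bigr => i _; rewrite Rintegral_sum//.
apply: eq_bigr => j _; rewrite RintegralZl//; last exact: iI.
by rewrite EI// pairE// chain_stationary// -EFinM /= [in LHS](mulrC (transition _ _ _ _)).
Qed.

Lemma chain_expectation phi u : 0 <= u ->
  \int[P]_w phi (X u w) = \sum_i p i * phi i.
Proof.
move=> u0; under eq_Rintegral do rewrite chain_decomposition.
have i1 i : P.-integrable setT (EFin \o (fun w => \1_(X u @^-1` [set i]) w)).
  apply: L2_integrable; apply: (@L2_prob_bounded _ _ _ _ _ 1).
    by apply: measurable_indic; exact: mX.
  by move=> w; rewrite indicE; case: (_ \in _); rewrite ?normr1 ?normr0.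
rewrite Rintegral_sum//; last by move=> i; exact: integrableZl_EFin.
apply: eq_bigr => i _; rewrite RintegralZl// mulrC; congr (_ * _).
rewrite /Rintegral integral_indic//; last exact: mX.
by rewrite setIT -[RHS]/(fine (p i)%:E) -(chain_stationary i u0).
Qed.

(** [enlarged_past] contains the whole path of the chain, so [u] may exceed [s]; functions of the
    chain thus qualify for [ito_orthogonal]. *)
Lemma chain_past (B : R -> {RV P >-> R}) phi u : 0 <= u ->
  forall s, sub_measurable (enlarged_past X B s) (fun w => phi (X u w)).
Proof.
move=> u0 s A _; apply: sub_sigma_algebra; left; exists u.
  by rewrite /= in_itv/= andbT.
by exists (phi @^-1` A) => //; rewrite setTI.
Qed.

End chain_moments.

(** * Discounted integrals *)

Section calculus.
Context (R : realType).
Local Notation mu := (@lebesgue_measure R).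
Implicit Types (f g : R -> R) (s t u : R).

Lemma lebesgue_measure_0t t : 0 <= t -> mu [set` `[0, t]] = t%:E.
Proof.
move=> t0; rewrite lebesgue_measure_itv /= lte_fin.
case: ltP => h0; first by rewrite oppr0 addr0.
by congr EFin; apply/le_anti; rewrite h0 t0.
Qed.

Lemma antiderivative_ex f : continuous f -> exists W : R -> R,
  (forall s, 0 <= s -> is_derive s (1 : R) W (f s)) /\
  (forall s, 0 <= s -> \int[mu]_(x in `[0, s]) f x = W s - W 0).
Proof.
move=> cf.
(* starting the integral at -1 makes it differentiable at 0 as well *)
exists (fun s => \int[mu]_(x in `[-1, s]) f x); split => s s0.
  have ss : s < s + 1 by rewrite ltrDl.
  have s1 : -1 < s by rewrite (lt_le_trans _ s0)// ltrN10.
  have [] := @continuous_FTC1_closed _ f (-1) s (s + 1) ss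
    (continuous_itv_integrable _ _ cf) s1 (cf s).
  by move=> d1 <-; rewrite derive1E; exact: DeriveDef.
have i1 := continuous_itv_integrable (-1) s cf.
rewrite (Rintegral_itvB i1) ?bnd_simp ?lerN10//.
rewrite Rintegral_itv_obnd_cbnd//.
by apply: integrableS (continuous_itv_integrable 0 s cf) => //; exact: subset_itv_oc_cc.
Qed.

Lemma Rintegral_right_continuous f s : continuous f -> 0 <= s ->
  (\int[mu]_(x in `[0, u]) f x) @[u --> s^'+] --> \int[mu]_(x in `[0, s]) f x.
Proof.
move=> cf s0; have [W [dW WE]] := antiderivative_ex cf; rewrite WE//.
have cW : W u - W 0 @[u --> s^'+] --> W s - W 0.
  apply: cvgB; last exact: cvg_cst.
  apply: cvg_at_right_filter; have h := dW s s0.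
  by apply/differentiable_continuous/derivable1_diffP.
apply: cvg_trans cW; apply: near_eq_cvg; near=> u; rewrite WE//.
by apply: (le_trans s0); near: u; exact: nbhs_right_ge.
Unshelve. all: by end_near. Qed.

Lemma Rintegral_reflect f t : continuous f -> 0 <= t ->
  \int[mu]_(s in `[0, t]) f (t - s) = \int[mu]_(s in `[0, t]) f s.
Proof.
move=> cf t0; have [W [dW WE]] := antiderivative_ex cf.
have cft : {in `[0, t], continuous (fun s => f (t - s))}.
  move=> s _; apply: (cvg_comp (fun s => t - s) f); last exact: cf.
  by apply: cvgB; [exact: cvg_cst|exact: cvg_id].
have dF s : 0 <= s <= t -> is_derive s (1 : R) (fun s => - W (t - s)) (f (t - s)).
  move=> /andP[s0 st]; have h := dW (t - s); rewrite subr_ge0 in h.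
  have {}h := h st.
  have h2 : is_derive s (1 : R) (fun s => t - s) (-1).
    apply: (is_derive_eq (is_deriveB (is_derive_cst t s 1) (is_derive_id s 1))).
    by rewrite sub0r.
  have h3 := @is_derive1_comp _ W (fun s => t - s) s _ _ h h2.
  by apply: (is_derive_eq (is_deriveN h3)); rewrite mulrN1 opprK.
have -> := Rintegral_FTC t0 cft dF.
by rewrite subrr subr0 WE//; ring.
Qed.

Lemma continuous_discount (gamma t : R) :
  continuous (fun s : R => expR (- gamma * (t - s))).
Proof.
move=> s; apply: (cvg_comp _ expR); last exact: continuous_expR.
apply: cvgMr; apply: cvgB; [exact: cvg_cst|exact: cvg_id].
Qed.

Lemma is_derive_discount (gamma t s : R) :
  is_derive s (1 : R) (fun s : R => expR (- gamma * (t - s)))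
    (gamma * expR (- gamma * (t - s))).
Proof. by apply: is_derive_eq; rewrite /GRing.scale /=; ring. Qed.

(** The integrating factor: the derivative of [expR (- gamma * (t - s))] times the integral of [f]
    over [[0, s]] is the same factor times [g s]. As the factor is 1 at [t], the discounted integral
    of [g] equals the integral of [f]. *)
Lemma linear_ode f (gamma t : R) : continuous f -> 0 <= t ->
  let g s := f s + gamma * \int[mu]_(u in `[0, s]) f u in
  f t = g t - gamma * \int[mu]_(s in `[0, t]) (expR (- gamma * (t - s)) * g s).
Proof.
move=> cf t0 g; have [W [dW WE]] := antiderivative_ex cf.
pose e s := expR (- gamma * (t - s)).
pose g' s := f s + gamma * (W s - W 0).
have gE s : 0 <= s -> g s = g' s by move=> s0; rewrite /g WE.
have cF : {in `[0, t], continuous (fun s => e s * g' s)}.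
  move=> s; rewrite in_itv/= => /andP[s0 _]; apply: cvgM.
    exact: continuous_discount.
  apply: cvgD; first exact: cf.
  apply: cvgMr; apply: cvgB; last exact: cvg_cst.
  by have h := dW s s0; apply/differentiable_continuous/derivable1_diffP.
have dF s : 0 <= s <= t ->
    is_derive s (1 : R) (fun s => e s * (W s - W 0)) (e s * g' s).
  move=> /andP[s0 _]; have h := dW s s0.
  have he := is_derive_discount gamma t s; rewrite -/(e s) in he.
  have hW := is_deriveB h (is_derive_cst (W 0) s 1).
  apply: (is_derive_eq (is_deriveM he hW)).
  rewrite -[(W - cst (W 0)) s]/(W s - W 0) -/(e s) /GRing.scale /= /g'; ring.
have -> : \int[mu]_(s in `[0, t]) (expR (- gamma * (t - s)) * g s) = W t - W 0.
  transitivity (\int[mu]_(s in `[0, t]) (e s * g' s)).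
    by apply: eq_Rintegral => s; rewrite mem_setE in_itv/= => /andP[s0 _]; rewrite gE.
  rewrite (Rintegral_FTC t0 cF dF) !subrr mulr0 subr0.
  by rewrite /e subrr mulr0 expR0 mul1r.
rewrite gE// /g'; ring.
Qed.

Section triangle.
Variables (h : measurableTypeR R * measurableTypeR R -> R) (t C : R).
Hypotheses (mh : measurable_fun setT h) (t0 : 0 <= t).
Hypothesis hC : forall s u, 0 <= s <= t -> 0 <= u <= t -> `|h (s, u)| <= C.

Let A : set (measurableTypeR R * measurableTypeR R) := [set z | z.2 <= z.1].

Let mA : measurable A.
Proof.
have -> : A = (fun z => z.1 - z.2) @^-1` `[0, +oo[.
  by apply/seteqP; split => z /=; rewrite in_itv/= andbT subr_ge0.
rewrite -[X in measurable X]setTI.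
apply: (@measurable_funB _ _ _ _ fst snd) => //.
Qed.

Let f z := h z * \1_A z.

Let mf : measurable_fun setT f.
Proof. by apply: measurable_funM => //; exact: measurable_indic. Qed.

Let fC s : `[0, t]%classic s ->
  (\int[mu]_(u in `[0%R, t]) `|f (s, u)|%:E <= (C * t)%:E)%E.
Proof.
rewrite /= in_itv/= => st.
rewrite EFinM -(lebesgue_measure_0t t0) -integral_cst//; apply: ge0_le_integral => //.
- apply/measurable_EFinP/measurable_funTS/measurableT_comp => //.
  exact: (measurableT_comp mf (measurable_pair1 s)).
- move=> u /=; rewrite in_itv/= => ut; rewrite lee_fin /f normrM.
  rewrite (le_trans _ (hC st ut))// ler_piMr// indicE.
  by case: (_ \in _); rewrite ?normr1 ?normr0.
Qed.

Let mu_fin : (mu [set` `[0%R, t]] < +oo)%E.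
Proof. by rewrite lebesgue_measure_0t// ltry. Qed.

Let mI : measurable ([set` `[0, t]] : set (measurableTypeR R)).
Proof. exact: measurable_itv. Qed.

Let inner1 s : 0 <= s <= t ->
  \int[mu]_(u in `[0, t]) f (s, u) = \int[mu]_(u in `[0, s]) h (s, u).
Proof.
move=> /andP[s0 st].
transitivity (\int[mu]_(u in `[0, t] `&` `[0, s]) h (s, u)).
  rewrite Rintegral_mkcondr; apply: eq_Rintegral => u.
  rewrite mem_setE in_itv/= => /andP[u0 ut]; rewrite patchE mem_setE in_itv/= u0 /=.
  rewrite /f indicE (_ : (_ \in A) = (u <= s)); last first.
    by apply/idP/idP => [/set_mem|?]; [|apply/mem_set].
  by case: (u <= s); rewrite ?mulr1 ?mulr0.
congr (Rintegral _ _ _); apply/seteqP; split => u /=; rewrite !in_itv/=.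
  by case.
by move=> /andP[u0 us]; rewrite u0 us (le_trans us st).
Qed.

Let inner2 u : 0 <= u <= t ->
  \int[mu]_(s in `[0, t]) f (s, u) = \int[mu]_(s in `[u, t]) h (s, u).
Proof.
move=> /andP[u0 ut].
transitivity (\int[mu]_(s in `[0, t] `&` `[u, t]) h (s, u)).
  rewrite Rintegral_mkcondr; apply: eq_Rintegral => s.
  rewrite mem_setE in_itv/= => /andP[s0 st]; rewrite patchE mem_setE in_itv/= st andbT.
  rewrite /f indicE (_ : (_ \in A) = (u <= s)); last first.
    by apply/idP/idP => [/set_mem|?]; [|apply/mem_set].
  by case: (u <= s); rewrite ?mulr1 ?mulr0.
congr (Rintegral _ _ _); apply/seteqP; split => s /=; rewrite !in_itv/=.
  by case.
by move=> /andP[us st]; rewrite us st (le_trans u0 us).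
Qed.

(** Fubini on the square [[0, t]] by [[0, t]] for [h] times the indicator of [u <= s]. *)
Lemma Rintegral_triangle :
  \int[mu]_(s in `[0, t]) \int[mu]_(u in `[0, s]) h (s, u) =
  \int[mu]_(u in `[0, t]) \int[mu]_(s in `[u, t]) h (s, u).
Proof.
have F := @Fubini_Rintegral _ _ _ _ _ mu mu _ _ mI mI f (C * t) mf mu_fin fC.
apply: etrans (etrans _ F) _; apply: eq_Rintegral => s.
  by rewrite mem_setE in_itv/= => st; rewrite inner1.
by rewrite mem_setE in_itv/= => st; rewrite inner2.
Qed.

Lemma triangle_integrable1 : mu.-integrable `[0, t]
  (EFin \o (fun s => \int[mu]_(u in `[0, s]) h (s, u))).
Proof.
have F := @Fubini_integrable1 _ _ _ _ _ mu mu _ _ mI mI f (C * t) mf mu_fin fC.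
by apply: eq_integrable F => // s; rewrite mem_setE in_itv/= => st; rewrite /= inner1.
Qed.

Lemma triangle_integrable2 : mu.-integrable `[0, t]
  (EFin \o (fun u => \int[mu]_(s in `[u, t]) h (s, u))).
Proof.
have F := @Fubini_integrable2 _ _ _ _ _ mu mu _ _ mI mI f (C * t) mf mu_fin fC.
by apply: eq_integrable F => // s; rewrite mem_setE in_itv/= => st; rewrite /= inner2.
Qed.

End triangle.

Lemma Rintegral_discount (gamma t u : R) : gamma != 0 -> u <= t ->
  \int[mu]_(s in `[u, t]) expR (- gamma * (t - s)) =
  (1 - expR (- gamma * (t - u))) / gamma.
Proof.
move=> gamma0 ut; pose e s := expR (- gamma * (t - s)).
have dF s : u <= s <= t -> is_derive s (1 : R) (fun s => gamma^-1 * e s) (e s).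
  move=> _; apply: (is_derive_eq (is_deriveZ gamma^-1 (is_derive_discount gamma t s))).
  by rewrite /GRing.scale /= mulKf.
rewrite (Rintegral_FTC ut _ dF); last by move=> s _; exact: continuous_discount.
by rewrite /e subrr mulr0 expR0; field.
Qed.

Section discount.
Variables (gamma t : R).
Hypotheses (gamma_gt0 : 0 < gamma) (t0 : 0 <= t).
Local Notation e s := (expR (- gamma * (t - s))).

Let gamma0 : gamma != 0. Proof. by rewrite gt_eqF. Qed.

Lemma discount_le1 s : s <= t -> e s <= 1.
Proof. by move=> st; rewrite -expR0 ler_expR mulNr oppr_le0 mulr_ge0 ?subr_ge0// ltW. Qed.

Lemma measurable_discount :
  measurable_fun [set: measurableTypeR R] (fun s => e s).
Proof. by apply: continuous_measurable_fun; exact: continuous_discount. Qed.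

Lemma Rintegral_discount0 :
  \int[mu]_(s in `[0, t]) e s = (1 - expR (- gamma * t)) / gamma.
Proof. by rewrite Rintegral_discount// subr0. Qed.

(** The operator that recovers [M t] from [G], applied to a primitive of [a]. Exchanging the order
    of integration leaves the discount integrated over [[u, t]], which is [(1 - e u) / gamma]; the
    undiscounted parts cancel. *)
Lemma discount_volterra (a : R -> R) (C : R) :
  mu.-integrable `[0, t] (EFin \o a) -> (forall u, 0 <= u <= t -> `|a u| <= C) ->
  mu.-integrable `[0, t] (EFin \o (fun s => e s * \int[mu]_(u in `[0, s]) a u)) /\
  \int[mu]_(u in `[0, t]) a u
   - gamma * \int[mu]_(s in `[0, t]) (e s * \int[mu]_(u in `[0, s]) a u) =
  \int[mu]_(u in `[0, t]) (e u * a u).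
Proof.
move=> ia aC.
have ma : measurable_fun `[0, t] a.
  by apply/measurable_EFinP; exact: measurable_int ia.
pose a' := a \_ `[0, t].
have aE u : 0 <= u <= t -> a' u = a u.
  by move=> ut; rewrite /a' patchE mem_setE in_itv/= ut.
have ma' : measurable_fun [set: measurableTypeR R] a'.
  by apply/(measurable_restrictT _ _).1 => //; exact: measurable_itv.
pose h (z : measurableTypeR R * measurableTypeR R) := e z.1 * a' z.2.
have mh : measurable_fun setT h.
  apply: measurable_funM; first exact: (measurableT_comp measurable_discount measurable_fst).
  exact: (measurableT_comp ma' measurable_snd).
have C0 : 0 <= C by rewrite (le_trans _ (aC 0 _))// lexx t0.
have hC s u : 0 <= s <= t -> 0 <= u <= t -> `|h (s, u)| <= C.
  move=> /andP[_ st] ut; rewrite /h normrM (ger0_norm (expR_ge0 _)) aE//.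
  by rewrite -[leRHS]mul1r ler_pM// ?expR_ge0 ?discount_le1// aC.
have ias s : 0 <= s <= t -> mu.-integrable `[0, s] (EFin \o a).
  move=> /andP[s0 st]; apply: integrableS ia => //.
  by apply: subset_itvl; rewrite bnd_simp.
have inner s : 0 <= s <= t ->
    \int[mu]_(u in `[0, s]) h (s, u) = e s * \int[mu]_(u in `[0, s]) a u.
  move=> /[dup] st /andP[s0 st']; rewrite -RintegralZl//; last exact: ias.
  apply: eq_Rintegral => u; rewrite mem_setE in_itv/= => /andP[u0 us].
  by rewrite /h aE// u0 (le_trans us).
split.
  have := triangle_integrable1 mh t0 hC; apply: eq_integrable => //.
  by move=> s; rewrite mem_setE in_itv/= => st; rewrite /= inner.
have iea : mu.-integrable `[0, t] (EFin \o (fun u => e u * a u)).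
  apply: le_integrable ia => //.
    apply/measurable_EFinP/measurable_funM.
      exact: measurable_funTS measurable_discount.
    exact: ma.
  move=> u /=; rewrite in_itv/= => /andP[_ ut].
  by rewrite lee_fin normrM ler_piMl// (ger0_norm (expR_ge0 _)) discount_le1.
have -> : \int[mu]_(s in `[0, t]) (e s * \int[mu]_(u in `[0, s]) a u) =
    \int[mu]_(s in `[0, t]) \int[mu]_(u in `[0, s]) h (s, u).
  by apply: eq_Rintegral => s; rewrite mem_setE in_itv/= => st; rewrite inner.
rewrite (Rintegral_triangle mh t0 hC).
have -> : \int[mu]_(u in `[0, t]) \int[mu]_(s in `[u, t]) h (s, u) =
    \int[mu]_(u in `[0, t]) (gamma^-1 * (a u - e u * a u)).
  apply: eq_Rintegral => u; rewrite mem_setE in_itv/= => /[dup] ut /andP[u0 ut'].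
  transitivity (\int[mu]_(s in `[u, t]) (e s * a u)).
    by apply: eq_Rintegral => s _; rewrite /h aE.
  rewrite RintegralZr//; last first.
    by apply: continuous_itv_integrable; exact: continuous_discount.
  by rewrite Rintegral_discount//; field.
rewrite RintegralZl//; last exact: integrableB_EFin.
by rewrite mulVKf// RintegralB// opprB addrC subrK.
Qed.

(** Change to the lag [v = |u - s|]. The two triangles of the square contribute equally; on
    [s <= u], with [s = u - v], the two discounts multiply to [expR (- (2 * gamma) * (t - u)) * expR
    (- gamma * v)], which is integrated over [u] in [[v, t]]. *)
Lemma discount_reflect (c : R -> R) : continuous c ->
  \int[mu]_(u in `[0, t]) (e u * \int[mu]_(s in `[0, t]) (e s * c `|u - s|)) =
  \int[mu]_(v in `[0, t])
    ((expR (- gamma * v) - expR (- gamma * (2 * t - v))) / gamma * c v).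
Proof.
move=> cc.
have ce := @continuous_discount gamma t.
have [C hC] : exists C, forall v, 0 <= v <= t -> `|c v| <= C.
  have cn : {within `[0, t], continuous (fun v => `|c v|)}.
    apply: continuous_subspaceT => v; apply: cvg_norm; exact: cc.
  have [v0 _ hv] := EVT_max t0 cn.
  by exists `|c v0| => v vt; apply: hv; rewrite in_itv.
have mc : measurable_fun [set: measurableTypeR R] c by exact: continuous_measurable_fun.
have me := measurable_discount.
have C0 : 0 <= C by rewrite (le_trans _ (hC 0 _))// lexx t0.
pose h1 (z : measurableTypeR R * measurableTypeR R) := e z.1 * e z.2 * c `|z.1 - z.2|.
pose h2 (z : measurableTypeR R * measurableTypeR R) := e z.1 * e (z.1 - z.2) * c z.2.
have mh1 : measurable_fun setT h1.
  apply: measurable_funM.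
    apply: measurable_funM; first exact: (measurableT_comp me measurable_fst).
    exact: (measurableT_comp me measurable_snd).
  apply: (measurableT_comp mc); apply: measurableT_comp => //.
  exact: measurable_funB.
have mh2 : measurable_fun setT h2.
  apply: measurable_funM; last exact: (measurableT_comp mc measurable_snd).
  apply: measurable_funM; first exact: (measurableT_comp me measurable_fst).
  apply: (measurableT_comp me); exact: measurable_funB.
have e1 s : s <= t -> `|e s| <= 1.
  by move=> st; rewrite (ger0_norm (expR_ge0 _)) discount_le1.
have ee1 x y z : x <= t -> y <= t -> 0 <= z <= t -> `|e x * e y * c z| <= C.
  move=> xt yt zt; rewrite !normrM -[leRHS]mul1r ler_pM ?mulr_ge0 ?hC//.
  by rewrite -[leRHS]mul1r ler_pM ?e1.
have h1C s u : 0 <= s <= t -> 0 <= u <= t -> `|h1 (s, u)| <= C.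
  move=> /andP[s0 st] /andP[u0 ut]; apply: ee1 => //=.
  by rewrite normr_ge0 ler_norml; apply/andP; split; lra.
have h2C s u : 0 <= s <= t -> 0 <= u <= t -> `|h2 (s, u)| <= C.
  move=> /andP[s0 st] /andP[u0 ut]; apply: ee1 => //=; [lra|].
  by rewrite u0.
have cabs u : continuous (fun s : R => c `|u - s|).
  move=> s; apply: (cvg_comp (fun s : R => `|u - s|) c); last exact: cc.
  by apply: cvg_norm; apply: cvgB; [exact: cvg_cst|exact: cvg_id].
have ch1 u : continuous (fun s : R => h1 (u, s)).
  move=> s; rewrite /h1 /=; apply: cvgM; last exact: cabs.
  by apply: cvgM; [exact: cvg_cst|exact: ce].
(* The inner interval is cut at [u]. On [[u, t]] the symmetry of [h1] swaps its arguments, so that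
   the second part becomes the same triangle integral as the first. *)
transitivity (\int[mu]_(u in `[0, t])
  (\int[mu]_(s in `[0, u]) h1 (u, s) + \int[mu]_(s in `[u, t]) h1 (s, u))).
  apply: eq_Rintegral => u; rewrite mem_setE in_itv/= => /andP[u0 ut].
  rewrite -RintegralZl//; last first.
    apply: continuous_itv_integrable => s; apply: cvgM; [exact: ce|exact: cabs].
  transitivity (\int[mu]_(s in `[0, t]) h1 (u, s)).
    by apply: eq_Rintegral => s _; rewrite /h1 mulrA.
  have i1 := continuous_itv_integrable 0 t (ch1 u).
  have := Rintegral_itvB i1; move=> /(_ u); rewrite !bnd_simp => /(_ u0 ut).
  rewrite Rintegral_itv_obnd_cbnd; last first.
    by apply: integrableS i1 => //; apply: subset_itvr; rewrite bnd_simp.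
  move=> /eqP; rewrite subr_eq addrC => /eqP ->; congr (_ + _).
  by apply: eq_Rintegral => s _; rewrite /h1 /= distrC; congr (_ * _); rewrite mulrC.
rewrite RintegralD//; last 2 first.
- exact: triangle_integrable1 mh1 t0 h1C.
- exact: triangle_integrable2 mh1 t0 h1C.
rewrite -(Rintegral_triangle mh1 t0 h1C).
have -> : \int[mu]_(u in `[0, t]) \int[mu]_(s in `[0, u]) h1 (u, s) =
    \int[mu]_(u in `[0, t]) \int[mu]_(v in `[0, u]) h2 (u, v).
  apply: eq_Rintegral => u; rewrite mem_setE in_itv/= => /andP[u0 ut].
  have cF : continuous (fun v => h2 (u, v)).
    move=> v; rewrite /h2 /=; apply: cvgM; last exact: cc.
    apply: cvgM; first exact: cvg_cst.
    apply: (cvg_comp (fun v => u - v) (fun s => e s)); last exact: ce.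
    by apply: cvgB; [exact: cvg_cst|exact: cvg_id].
  rewrite -(Rintegral_reflect cF u0); apply: eq_Rintegral => s.
  rewrite mem_setE in_itv/= => /andP[s0 su].
  by rewrite /h1 /h2 /= subKr ger0_norm ?subr_ge0.
rewrite (Rintegral_triangle mh2 t0 h2C).
(* The contribution of one triangle, whence [2 * gamma]; adding both restores [gamma]. *)
pose k v := (expR (- gamma * v) - expR (- gamma * (2 * t - v))) / (2 * gamma) * c v.
have kE : \int[mu]_(u in `[0, t]) \int[mu]_(s in `[u, t]) h2 (s, u) =
    \int[mu]_(v in `[0, t]) k v.
  apply: eq_Rintegral => v; rewrite mem_setE in_itv/= => /andP[v0 vt].
  transitivity (\int[mu]_(u in `[v, t])
      (expR (- (2 * gamma) * (t - u)) * (expR (- gamma * v) * c v))).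
    apply: eq_Rintegral => u _; rewrite /h2 /= mulrA -!expRD.
    by congr (expR _ * _); ring.
  rewrite RintegralZr//; last first.
    by apply: continuous_itv_integrable; exact: continuous_discount.
  rewrite Rintegral_discount ?mulf_neq0 ?pnatr_eq0// /k.
  have -> : expR (- gamma * (2 * t - v)) =
      expR (- (2 * gamma) * (t - v)) * expR (- gamma * v).
    by rewrite -expRD; congr expR; ring.
  by field.
have ck : continuous k.
  move=> v; apply: cvgM; last exact: cc.
  apply: cvgMl; apply: cvgB.
    apply: (cvg_comp _ expR); last exact: continuous_expR.
    by apply: cvgMr; exact: cvg_id.
  apply: (cvg_comp _ expR); last exact: continuous_expR.
  by apply: cvgMr; apply: cvgB; [exact: cvg_cst|exact: cvg_id].
rewrite kE -RintegralD//; try exact: continuous_itv_integrable.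
by apply: eq_Rintegral => v _; rewrite /k; field.
Qed.

Lemma Rintegral_discount_min r : 0 <= r <= t ->
  \int[mu]_(s in `[0, t]) (e s * Num.min s r) =
  (r - (e r - e 0) / gamma) / gamma.
Proof.
move=> /andP[r0 rt].
have ce := @continuous_discount gamma t.
have cm : continuous (fun s : R => e s * Num.min s r).
  move=> s; apply: cvgM; first exact: ce.
  by apply: continuous_min; [exact: cvg_id|exact: cvg_cst].
have i1 := continuous_itv_integrable 0 t cm.
have := Rintegral_itvB i1; move=> /(_ r); rewrite !bnd_simp => /(_ r0 rt).
rewrite Rintegral_itv_obnd_cbnd; last first.
  by apply: integrableS i1 => //; apply: subset_itvr; rewrite bnd_simp.
move=> /eqP; rewrite subr_eq addrC => /eqP ->.
have -> : \int[mu]_(s in `[r, t]) (e s * Num.min s r) = (1 - e r) / gamma * r.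
  transitivity (\int[mu]_(s in `[r, t]) (e s * r)).
    apply: eq_Rintegral => s; rewrite mem_setE in_itv/= => /andP[rs _].
    by rewrite min_r.
  by rewrite RintegralZr ?Rintegral_discount//; exact: continuous_itv_integrable.
(* An antiderivative of [e s * s], found by parts. *)
pose F (s : R) := gamma^-1 * (e s * (s - gamma^-1)).
have dF s : 0 <= s <= r -> is_derive s (1 : R) F (e s * s).
  move=> _; have he := is_derive_discount gamma t s.
  have hs := is_deriveB (is_derive_id s 1) (is_derive_cst gamma^-1 s 1).
  apply: (is_derive_eq (is_deriveZ gamma^-1 (is_deriveM he hs))).
  rewrite -[(id - cst gamma^-1) s]/(s - gamma^-1) /GRing.scale /=; field.
  done.
have -> : \int[mu]_(s in `[0, r]) (e s * Num.min s r) = F r - F 0.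
  transitivity (\int[mu]_(s in `[0, r]) (e s * s)).
    apply: eq_Rintegral => s; rewrite mem_setE in_itv/= => /andP[_ sr].
    by rewrite min_l.
  apply: Rintegral_FTC => // s _; apply: cvgM; [exact: ce|exact: cvg_id].
by rewrite /F; field.
Qed.

End discount.
End calculus.

Section auxiliary.
Context (disp : measure_display) (T : measurableType disp) (R : realType).
Variable P : probability T R.
Local Notation mu := (@lebesgue_measure R).

(** Tonelli makes the integrals of the positive and negative parts measurable in [w]; their
    difference and [fine] preserve this, also at points where the integral is infinite. *)
Lemma measurable_Rintegral_param (f : measurableTypeR R * T -> R) (s : R) :
  measurable_fun setT f ->
  measurable_fun setT (fun w => \int[mu]_(u in `[0, s]) f (u, w)).
Proof.
move=> mf; pose g z : \bar R := (f z * \1_(`[0, s]%classic : set (measurableTypeR R)) z.1)%:E.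
have mg : measurable_fun setT g.
  apply/measurable_EFinP; apply: measurable_funM => //.
  by apply: (measurableT_comp _ measurable_fst); exact: measurable_indic.
have -> : (fun w => \int[mu]_(u in `[0, s]) f (u, w)) =
    fine \o (fun w => \int[mu]_u g^\+ (u, w) - \int[mu]_u g^\- (u, w))%E.
  apply/funext => w /=; rewrite /Rintegral; congr fine.
  transitivity (\int[mu]_u g (u, w))%E.
    rewrite integral_mkcond; apply: eq_integral => u _.
    by rewrite patchE /g indicE /=; case: (_ \in _); rewrite ?mulr1 ?mulr0.
  rewrite integralE; congr (_ - _)%E; apply: eq_integral => u _.
    by rewrite !funeposE.
  by rewrite !funenegE.
apply: measurableT_comp => //; apply: emeasurable_funB.
  apply: (measurable_fun_fubini_tonelli_G (g^\+)%E) => //; exact: measurable_funepos.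
apply: (measurable_fun_fubini_tonelli_G (g^\-)%E) => //; exact: measurable_funeneg.
Qed.

Lemma bounded_section_integrable (Y : R -> T -> R) (K : R) :
  measurable_fun setT (fun z : measurableTypeR R * T => Y z.1 z.2) ->
  (forall u w, `|Y u w| <= K) ->
  forall w s, mu.-integrable `[0, s] (EFin \o (Y ^~ w)).
Proof.
move=> mY YK w s.
have mYw : measurable_fun [set: measurableTypeR R] (Y ^~ w).
  exact: (measurableT_comp mY (measurable_pair2 w)).
apply: measurable_bounded_integrable => //.
- by rewrite /= lebesgue_measure_itv /=; case: ifP => _; rewrite ?ltry// -EFinB ltry.
- exact: measurable_funTS.
- by exists K; split=> [|y Ky x _]; [exact: num_real|exact: le_trans (YK _ _) (ltW Ky)].
Qed.

Lemma continuous_comp_max (f : R -> R) : {within `[0, +oo[, continuous f} ->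
  continuous (fun s : R => f (Num.max s 0)).
Proof.
move=> cf x.
have cm : Num.max y 0 @[y --> x] --> Num.max x 0.
  by apply: continuous_max; [exact: cvg_id|exact: cvg_cst].
have Ax : (`[0, +oo[%classic : set R) (Num.max x 0).
  by rewrite /= in_itv/= andbT le_max lexx orbT.
have /subspace_continuousP/(_ _ Ax) h := cf.
move=> U /h hU.
have {}hU : nbhs (Num.max x 0) [set y : R | `[0, +oo[%classic y -> U (f y)] := hU.
have : \forall y \near x, `[0, +oo[%classic (Num.max y 0) -> U (f (Num.max y 0)).
  exact: (cm _ hU).
apply: filterS => y; apply.
by rewrite /= in_itv/= andbT le_max lexx orbT.
Qed.

Lemma ae_Rintegral (f g : T -> R) : measurable_fun setT f -> measurable_fun setT g ->
  {ae P, forall w, f w = g w} -> \int[P]_w f w = \int[P]_w g w.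
Proof.
move=> mf mg fg; congr fine; apply: ae_eq_integral => //.
- exact/measurable_EFinP.
- exact/measurable_EFinP.
- by apply: filterS fg => w h _; rewrite h.
Qed.

Lemma L2_ae (f g : T -> R) : measurable_fun setT f -> L2 P setT g ->
  {ae P, forall w, f w = g w} ->
  L2 P setT f /\ \int[P]_w f w ^+ 2 = \int[P]_w g w ^+ 2.
Proof.
move=> mf [mg ig] fg.
have fg2 : {ae P, forall w, f w ^+ 2 = g w ^+ 2} by apply: filterS fg => w ->.
have E : (\int[P]_w (f w ^+ 2)%:E = \int[P]_w (g w ^+ 2)%:E)%E.
  apply: ae_eq_integral => //.
  - exact/measurable_EFinP/measurable_funX.
  - exact/measurable_EFinP/measurable_funX.
  - by apply: filterS fg2 => w h _; rewrite h.
split; last by rewrite /Rintegral E.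
split=> //; apply/integrableP; split; first exact/measurable_EFinP/measurable_funX.
under eq_integral do rewrite abse_EFin ger0_norm ?sqr_ge0//.
by rewrite E; exact: integrable_lty ig.
Qed.

(** Before time 0 the primitive is frozen at its value there, to obtain a function continuous on the
    whole line. *)
Lemma primitive_continuous (f : R -> R) : continuous f ->
  exists2 g : R -> R, continuous g &
    forall s, 0 <= s -> \int[mu]_(u in `[0, s]) f u = g s.
Proof.
move=> cf; have [W [dW WE]] := antiderivative_ex cf.
exists (fun s => W (Num.max s 0) - W 0); last by move=> s s0; rewrite max_l// WE.
move=> s; apply: cvgB; last exact: cvg_cst.
have cm : Num.max y 0 @[y --> s] --> Num.max s 0.
  by apply: continuous_max; [exact: cvg_id|exact: cvg_cst].
apply: (cvg_comp _ _ cm).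
have h := dW (Num.max s 0); rewrite le_max lexx orbT in h; have {}h := h isT.
have cW : {for Num.max s 0, continuous W}.
  by apply/differentiable_continuous/derivable1_diffP.
exact: cW.
Qed.

Lemma Rintegral_prob_cst (c : R) : \int[P]_w c = c.
Proof.
rewrite /Rintegral integral_cst//=; transitivity (fine (c%:E * 1)%E).
  by congr (fine (_ * _)%E); exact: probability_setT.
by rewrite mule1.
Qed.

Lemma ae_measurable_modification (f : T -> Prop) : {ae P, forall w, f w} ->
  exists2 N : set T, measurable N & P N = 0%E /\ (forall w, ~ N w -> f w).
Proof.
move=> [N [mN PN sub]]; exists N => //; split=> // w nN.
by apply: contrapT => nf; apply: nN; exact: sub.
Qed.

(** Since [|Z * H| <= Z ^+ 2 + H ^+ 2], the second moments bounded uniformly in [u] give the uniform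
    bound on the inner integrals that Fubini requires. *)
Lemma Fubini_L2 (H : measurableTypeR R * T -> R) (C s : R) (Z : T -> R) :
  0 <= s -> measurable_fun setT H -> L2 P setT Z ->
  (forall u, 0 <= u <= s -> L2 P setT (fun w => H (u, w)) /\
     \int[P]_w H (u, w) ^+ 2 <= C) ->
  [/\ mu.-integrable `[0, s] (EFin \o (fun u => \int[P]_w (Z w * H (u, w)))),
    P.-integrable setT (EFin \o (fun w => \int[mu]_(u in `[0, s]) (Z w * H (u, w)))) &
    \int[mu]_(u in `[0, s]) \int[P]_w (Z w * H (u, w)) =
    \int[P]_w \int[mu]_(u in `[0, s]) (Z w * H (u, w))].
Proof.
move=> s0 mH LZ hH.
pose f (z : measurableTypeR R * T) := Z z.2 * H z.
have mf : measurable_fun setT f.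
  by apply: measurable_funM => //; exact: (measurableT_comp LZ.1 measurable_snd).
have mI : measurable ([set` `[0, s]] : set (measurableTypeR R)) by exact: measurable_itv.
have ms : (mu [set` `[0%R, s]] < +oo)%E by rewrite lebesgue_measure_0t// ltry.
have fC u : [set` `[0, s]] u ->
    (\int[P]_(w in setT) `|f (u, w)|%:E <= (\int[P]_w Z w ^+ 2 + C)%:E)%E.
  rewrite /= in_itv/= => us; have [LH HC] := hH u us.
  have iZH := integrableD_EFin measurableT LZ.2 LH.2.
  apply: (@le_trans _ _ (\int[P]_w (Z w ^+ 2 + H (u, w) ^+ 2)%:E)%E).
    apply: ge0_le_integral => //.
    - apply/measurable_EFinP/measurableT_comp => //.
      by apply: measurable_funM; [exact: LZ.1|exact: LH.1].
    - exact: measurable_int iZH.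
    - move=> w _; rewrite lee_fin /f /= ler_norml; apply/andP; split; nra.
  rewrite -[leLHS]fineK; last exact: integrable_fin_num iZH.
  rewrite lee_fin -/(Rintegral _ _ _) RintegralD//; last 2 first.
  - exact: LZ.2.
  - exact: LH.2.
  by rewrite lerD2l.
split.
- exact: (@Fubini_integrable1 _ _ _ _ _ mu P _ _ mI measurableT f _ mf ms fC).
- exact: (@Fubini_integrable2 _ _ _ _ _ mu P _ _ mI measurableT f _ mf ms fC).
- exact: (@Fubini_Rintegral _ _ _ _ _ mu P _ _ mI measurableT f _ mf ms fC).
Qed.

End auxiliary.

(** * The linear equation in mean square *)

Section volterra_moments.
Context (disp : measure_display) (T : measurableType disp) (R : realType).
Variable P : probability T R.
Local Notation mu := (@lebesgue_measure R).
Variables (M Y : R -> T -> R) (I : R -> {RV P >-> R}) (m0 gamma v K t : R).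
Hypotheses (gamma_gt0 : 0 < gamma) (t0 : 0 <= t).
Hypothesis mY : measurable_fun setT (fun z : measurableTypeR R * T => Y z.1 z.2).
Hypothesis YK : forall u w, `|Y u w| <= K.
Hypothesis LI : forall s : R, 0 <= s -> L2 P setT (I s).
Hypothesis EI : forall s : R, 0 <= s -> \int[P]_w I s w ^+ 2 = v * s.
Hypothesis cM : forall w, continuous (fun s => M s w).
Hypothesis mM : forall s : R, 0 <= s -> measurable_fun setT (M s).
Hypothesis hM : forall s : R, 0 <= s -> {ae P, forall w, M s w =
  m0 + (\int[mu]_(u in `[0, s]) Y u w - gamma * \int[mu]_(u in `[0, s]) M u w) + I s w}.
Implicit Types (s u : R) (Z : T -> R).

Local Notation e s := (expR (- gamma * (t - s))).
Let A s w := \int[mu]_(u in `[0, s]) Y u w.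
(* Defined through M, hence continuous in s; it agrees with m0 + A s + I s only
   almost surely for each fixed s, and I need not have measurable paths. *)
Let G s w := M s w + gamma * \int[mu]_(u in `[0, s]) M u w.

Let K0 : 0 <= K.
Proof. by rewrite (le_trans _ (YK 0 point)). Qed.

Let mYs u : measurable_fun setT (Y u).
Proof. exact: (measurableT_comp mY (measurable_pair1 u)). Qed.

Let mA s : measurable_fun setT (A s).
Proof. exact: (@measurable_Rintegral_param _ _ _ (fun z => Y z.1 z.2)). Qed.

Let iYw s w : mu.-integrable `[0, s] (EFin \o (Y ^~ w)).
Proof. exact: bounded_section_integrable mY YK w s. Qed.

Let A_le s w : 0 <= s -> `|A s w| <= K * s.
Proof.
move=> s0; apply: (le_trans (le_normr_Rintegral _ (iYw s w))) => //.
have -> : K * s = \int[mu]_(u in `[0, s]) (cst K) u.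
  by rewrite Rintegral_cst//= lebesgue_measure_0t.
apply: le_Rintegral => //.
- exact: integrable_norm (iYw s w).
- by apply: continuous_itv_integrable; exact: cst_continuous.
Qed.

Let mMj : measurable_fun setT (fun z : measurableTypeR R * T => M (Num.max z.1 0) z.2).
Proof.
apply: right_continuous_jointly_measurable => // w s _.
by apply: cvg_at_right_filter; exact: cM.
Qed.

Let mG s : 0 <= s -> measurable_fun setT (G s).
Proof.
move=> s0; apply: measurable_funD; first exact: mM.
apply: measurable_funM => //.
have := measurable_Rintegral_param s mMj.
congr measurable_fun; apply/funext => w; apply: eq_Rintegral => u.
by rewrite mem_setE in_itv/= => /andP[u0 _]; rewrite max_l.
Qed.

Let mGj : measurable_fun setT (fun z : measurableTypeR R * T => G (Num.max z.1 0) z.2).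
Proof.
apply: right_continuous_jointly_measurable => // w s s0.
apply: cvgD; first by apply: cvg_at_right_filter; exact: cM.
by apply: cvgMr; apply: Rintegral_right_continuous => //; exact: cM.
Qed.

Let G_ae s : 0 <= s -> {ae P, forall w, G s w = m0 + A s w + I s w}.
Proof. by move=> s0; apply: filterS (hM s0) => w; rewrite /G /A => ->; ring. Qed.

Let LA s : 0 <= s -> L2 P setT (A s).
Proof. by move=> s0; apply: (@L2_prob_bounded _ _ _ _ _ (K * s)) => // w; exact: A_le. Qed.

Let L1 (c : R) : L2 P setT (fun=> c).
Proof. by apply: (@L2_prob_bounded _ _ _ _ _ `|c|). Qed.

Let LmAI s : 0 <= s -> L2 P setT (fun w => m0 + A s w + I s w).
Proof.
by move=> s0; apply: L2D => //; [apply: L2D => //; exact: LA|exact: LI].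
Qed.

Let LG s : 0 <= s -> L2 P setT (G s).
Proof. by move=> s0; have [] := L2_ae (mG s0) (LmAI s0) (G_ae s0). Qed.

(** From [(x + y + z) ^+ 2 <= 3 * (x ^+ 2 + y ^+ 2 + z ^+ 2)] with [|A s w| <= K * t] and
    [E (I s ^+ 2) <= v * t]. *)
Let CG := 3 * (m0 ^+ 2 + (K * t) ^+ 2 + v * t).

Let EG2 s : 0 <= s <= t -> \int[P]_w G s w ^+ 2 <= CG.
Proof.
move=> /andP[s0 st]; have [_ ->] := L2_ae (mG s0) (LmAI s0) (G_ae s0).
have v0 : 0 <= v.
  have := EI ler01; rewrite mulr1 => <-.
  by apply: Rintegral_ge0 => w _; exact: sqr_ge0.
have LIs := LI s0.
apply: (@le_trans _ _ (\int[P]_w (3 * (m0 ^+ 2 + (K * t) ^+ 2) + 3 * I s w ^+ 2))).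
  apply: le_Rintegral => //.
  - exact: (LmAI s0).2.
  - apply: integrableD_EFin => //; first exact: L2_integrable (L1 _).
    by apply: integrableZl_EFin => //; exact: LIs.2.
  - move=> w _.
    have h1 : A s w ^+ 2 <= (K * t) ^+ 2.
      rewrite -[leLHS]real_normK ?num_real// lerXn2r ?nnegrE ?mulr_ge0//.
      by rewrite (le_trans (A_le w s0))// ler_wpM2l.
    have := sqr_ge0 (m0 - A s w); have := sqr_ge0 (m0 - I s w).
    have := sqr_ge0 (A s w - I s w); nra.
rewrite RintegralD//; last 2 first.
- exact: L2_integrable (L1 _).
- by apply: integrableZl_EFin => //; exact: LIs.2.
rewrite [X in _ + X]RintegralZl//; last exact: LIs.2.
rewrite EI// Rintegral_prob_cst /CG.
have : v * s <= v * t by rewrite ler_wpM2l.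
lra.
Qed.

Let LY u : L2 P setT (Y u) /\ \int[P]_w Y u w ^+ 2 <= K ^+ 2.
Proof.
have L : L2 P setT (Y u) by apply: (@L2_prob_bounded _ _ _ _ _ K).
split=> //; apply: (@le_trans _ _ (\int[P]_w (cst (K ^+ 2)) w)); last first.
  by rewrite Rintegral_prob_cst.
apply: le_Rintegral => //; [exact: L.2|exact: L2_integrable (L1 _)|].
move=> w _; rewrite -[leLHS]real_normK ?num_real// lerXn2r ?nnegrE//; exact: YK.
Qed.

Let EZY Z s : 0 <= s -> L2 P setT Z ->
  mu.-integrable `[0, s] (EFin \o (fun u => \int[P]_w (Z w * Y u w))) /\
  \int[P]_w (Z w * A s w) = \int[mu]_(u in `[0, s]) \int[P]_w (Z w * Y u w).
Proof.
move=> s0 LZ; have [i1 _ ->] := Fubini_L2 s0 mY LZ (fun u _ => LY u).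
split=> //; apply: eq_Rintegral => w _; rewrite RintegralZl//; exact: iYw.
Qed.

(** At a fixed time [G s] may be replaced by [m0 + A s + I s] under the expectation; this is the
    only way in which [I] enters the computation. *)
Let EZG Z s : 0 <= s -> L2 P setT Z ->
  \int[P]_w (Z w * G s w) = m0 * \int[P]_w Z w +
  \int[mu]_(u in `[0, s]) \int[P]_w (Z w * Y u w) + \int[P]_w (Z w * I s w).
Proof.
move=> s0 LZ.
transitivity (\int[P]_w ((m0 * Z w + Z w * A s w) + Z w * I s w)).
  apply: ae_Rintegral.
  - by apply: measurable_funM; [exact: LZ.1|exact: mG].
  - apply: measurable_funD; last by apply: measurable_funM => //; exact: LZ.1.
    apply: measurable_funD; first by apply: measurable_funM => //; exact: LZ.1.
    by apply: measurable_funM => //; exact: LZ.1.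
  - by apply: filterS (G_ae s0) => w ->; ring.
have iZ := L2_integrable LZ.
have iZA := L2_integrableM measurableT LZ (LA s0).
have iZI := L2_integrableM measurableT LZ (LI s0).
have imZ := integrableZl_EFin measurableT m0 iZ.
rewrite RintegralD//; last exact: integrableD_EFin.
by rewrite RintegralD// RintegralZl// (EZY s0 LZ).2.
Qed.

Let H (z : measurableTypeR R * T) := e z.1 * G (Num.max z.1 0) z.2.

Let mH : measurable_fun setT H.
Proof.
apply: measurable_funM => //.
exact: (measurableT_comp (measurable_discount gamma t) measurable_fst).
Qed.

Let LH u : 0 <= u <= t -> L2 P setT (fun w => H (u, w)) /\
  \int[P]_w H (u, w) ^+ 2 <= CG.
Proof.
move=> /[dup] ut /andP[u0 ut'].
have e1 : `|e u| <= 1 by rewrite (ger0_norm (expR_ge0 _)) discount_le1.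
have HG w : `|H (u, w)| <= `|G u w|.
  by rewrite /H /= max_l// normrM ler_piMl.
have L : L2 P setT (fun w => H (u, w)).
  apply: (L2_le measurableT _ (LG u0)) => //.
  exact: (measurableT_comp mH (measurable_pair1 u)).
split=> //; apply: le_trans (EG2 ut); apply: le_Rintegral => //.
- exact: L.2.
- exact: (LG u0).2.
- move=> w _; rewrite -[leLHS]real_normK ?num_real// -[leRHS]real_normK ?num_real//.
  by rewrite lerXn2r ?nnegrE.
Qed.

Let V w := \int[mu]_(s in `[0, t]) (e s * G s w).

Let path_continuous w : exists2 g : R -> R, continuous g &
  forall s, 0 <= s -> e s * G s w = g s.
Proof.
have [g cg gE] := primitive_continuous (@cM w).
exists (fun s => e s * (M s w + gamma * g s)); last by move=> s s0; rewrite /G gE.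
move=> s; apply: cvgM; first exact: continuous_discount.
by apply: cvgD; [exact: cM|apply: cvgMr; exact: cg].
Qed.

Let ipath w : mu.-integrable `[0, t] (EFin \o (fun s => e s * G s w)).
Proof.
have [g cg gE] := path_continuous w.
have := continuous_itv_integrable 0 t cg; apply: eq_integrable => // s.
by rewrite mem_setE in_itv/= => /andP[s0 _]; rewrite /= gE.
Qed.

Let pathL2 w : L2 mu `[0, t] (fun s => e s * G s w).
Proof.
have [g cg gE] := path_continuous w; split.
  by apply/measurable_EFinP; exact: measurable_int (ipath w).
have cg2 : continuous (fun s => g s ^+ 2).
  by move=> s; apply: cvgM; exact: cg.
have := continuous_itv_integrable 0 t cg2; apply: eq_integrable => // s.
by rewrite mem_setE in_itv/= => /andP[s0 _]; rewrite /= gE.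
Qed.

Let VH w : V w = \int[mu]_(s in `[0, t]) H (s, w).
Proof.
apply: eq_Rintegral => s; rewrite mem_setE in_itv/= => /andP[s0 _].
by rewrite /H /= max_l.
Qed.

Let MGV w : M t w = G t w - gamma * V w.
Proof. by move: (linear_ode gamma (@cM w) t0) => /=; exact. Qed.

Let mV : measurable_fun setT V.
Proof.
rewrite (_ : V = fun w => \int[mu]_(s in `[0, t]) H (s, w)).
  exact: measurable_Rintegral_param.
by apply/funext => w; rewrite VH.
Qed.

Let EZV Z : L2 P setT Z -> P.-integrable setT (EFin \o (fun w => Z w * V w)) /\
  \int[P]_w (Z w * V w) =
  \int[mu]_(s in `[0, t]) (e s * \int[P]_w (Z w * G s w)).
Proof.
move=> LZ; have [i1 i2 E] := Fubini_L2 t0 mH LZ LH.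
have ZV w : Z w * V w = \int[mu]_(u in `[0, t]) (Z w * H (u, w)).
  rewrite VH RintegralZl//; have := ipath w; apply: eq_integrable => // s.
  by rewrite mem_setE in_itv/= => /andP[s0 _]; rewrite /= /H /= max_l.
split.
  by have := i2; congr integrable; apply/funext => w /=; rewrite ZV.
transitivity (\int[P]_w \int[mu]_(u in `[0, t]) (Z w * H (u, w))).
  by apply: eq_Rintegral => w _; rewrite ZV.
rewrite -E; apply: eq_Rintegral => s; rewrite mem_setE in_itv/= => /andP[s0 _].
have iZG := L2_integrableM measurableT LZ (LG s0).
rewrite -(RintegralZl (e s) measurableT iZG).
by apply: eq_Rintegral => w _; rewrite /H /= max_l//; ring.
Qed.

(** Cauchy-Schwarz in time against the constant 1 bounds [V w ^+ 2] by [t] times the time integral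
    of [H ^+ 2], which is integrable in [w] by Fubini and the bound [CG]. *)
Let LV : L2 P setT V.
Proof.
split=> //.
pose f (z : measurableTypeR R * T) := H z ^+ 2.
have mf : measurable_fun setT f by exact: measurable_funX.
have mI : measurable ([set` `[0, t]] : set (measurableTypeR R)) by exact: measurable_itv.
have ms : (mu [set` `[0%R, t]] < +oo)%E by rewrite lebesgue_measure_0t// ltry.
have fC u : [set` `[0, t]] u -> (\int[P]_(w in setT) `|f (u, w)|%:E <= CG%:E)%E.
  rewrite /= in_itv/= => /LH[L HC].
  under eq_integral do rewrite ger0_norm ?sqr_ge0//.
  rewrite -[leLHS]fineK; last exact: integrable_fin_num L.2.
  by rewrite lee_fin.
have i2 := @Fubini_integrable2 _ _ _ _ _ mu P _ _ mI measurableT f _ mf ms fC.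
apply: le_integrable (integrableZl_EFin measurableT t i2) => //.
  by apply/measurable_EFinP; exact: measurable_funX.
move=> w _ /=; rewrite lee_fin.
have i0 : 0 <= \int[mu]_(s in `[0, t]) f (s, w).
  by apply: Rintegral_ge0 => s _; exact: sqr_ge0.
rewrite (ger0_norm (sqr_ge0 _)) [leRHS]ger0_norm ?mulr_ge0//.
have Lone : L2 mu `[0, t] (fun=> 1 : R).
  split=> //; apply: continuous_itv_integrable => x; exact: cvg_cst.
have := L2_Cauchy_Schwarz mI Lone (pathL2 w).
under eq_Rintegral do rewrite mul1r.
rewrite -/(V w).
have -> : \int[mu]_(s in `[0, t]) (1 : R) ^+ 2 = t.
  under eq_Rintegral do rewrite expr1n.
  by rewrite Rintegral_cst//= lebesgue_measure_0t// mul1r.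
have -> : \int[mu]_(s in `[0, t]) (e s * G s w) ^+ 2 = \int[mu]_(s in `[0, t]) f (s, w).
  apply: eq_Rintegral => s; rewrite mem_setE in_itv/= => /andP[s0 _].
  by rewrite /f /H /= max_l.
move=> h; rewrite -[leLHS]real_normK ?num_real//.
apply: (@le_trans _ _ ((Num.sqrt t * Num.sqrt (\int[mu]_(s in `[0, t]) f (s, w))) ^+ 2)).
  by rewrite lerXn2r ?nnegrE ?mulr_ge0 ?sqrtr_ge0.
by rewrite exprMn !sqr_sqrtr.
Qed.

Lemma volterra_drift_integrable Z : L2 P setT Z ->
  mu.-integrable `[0, t] (EFin \o (fun u => \int[P]_w (Z w * Y u w))).
Proof. by move=> LZ; have [] := EZY t0 LZ. Qed.

Lemma volterra_L2 : L2 P setT (M t).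
Proof.
have -> : M t = (fun w => G t w - gamma * V w) by apply/funext => w; exact: MGV.
by apply: L2B => //; [exact: LG|exact: L2Z].
Qed.

(** The moment formula of the overview for a general [Z], with its two inputs [a] and [b] left
    abstract; every moment of the main proof is an instance. *)
Lemma volterra_moment Z (a b : R -> R) : L2 P setT Z ->
  (forall u, 0 <= u <= t -> \int[P]_w (Z w * Y u w) = a u) ->
  (forall s, 0 <= s <= t -> \int[P]_w (Z w * I s w) = b s) ->
  mu.-integrable `[0, t] (EFin \o b) ->
  \int[P]_w (Z w * M t w) = m0 * expR (- gamma * t) * \int[P]_w Z w +
    \int[mu]_(u in `[0, t]) (e u * a u) +
    (b t - gamma * \int[mu]_(s in `[0, t]) (e s * b s)).
Proof.
move=> LZ aE bE ib.
have tt : 0 <= t <= t by rewrite t0 lexx.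
have [ia _] := EZY t0 LZ.
have {}ia : mu.-integrable `[0, t] (EFin \o a).
  apply: eq_integrable ia => // u; rewrite mem_setE in_itv/= => ut.
  by rewrite /= aE.
(* Boundedness of the drift gives the uniform bound asked for by [discount_volterra]. *)
have aC u : 0 <= u <= t -> `|a u| <= K * \int[P]_w `|Z w|.
  move=> ut; rewrite -aE//; have iZY := L2_integrableM measurableT LZ (LY u).1.
  apply: (le_trans (le_normr_Rintegral measurableT iZY)).
  have iZn := integrable_norm (L2_integrable LZ).
  rewrite -RintegralZl//; apply: le_Rintegral => //.
  - exact: integrable_norm iZY.
  - exact: integrableZl_EFin.
  - by move=> w _; rewrite normrM mulrC ler_wpM2r.
have aEs s : 0 <= s <= t -> \int[mu]_(u in `[0, s]) \int[P]_w (Z w * Y u w) =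
    \int[mu]_(u in `[0, s]) a u.
  move=> /andP[_ st]; apply: eq_Rintegral => u; rewrite mem_setE in_itv/=.
  by move=> /andP[u0 us]; rewrite aE// u0 (le_trans us).
have [iea va] := discount_volterra gamma_gt0 t0 ia aC.
have [iZV EZVE] := EZV LZ.
transitivity (\int[P]_w (Z w * G t w - gamma * (Z w * V w))).
  by apply: eq_Rintegral => w _; rewrite MGV; ring.
have iZG := L2_integrableM measurableT LZ (LG t0).
rewrite RintegralB//; last exact: integrableZl_EFin.
rewrite RintegralZl// EZVE EZG// aEs// bE//.
set z := \int[P]_w Z w.
have -> : \int[mu]_(s in `[0, t]) (e s * \int[P]_w (Z w * G s w)) =
   \int[mu]_(s in `[0, t]) ((m0 * z * e s +
      e s * \int[mu]_(u in `[0, s]) a u) + e s * b s).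
  apply: eq_Rintegral => s; rewrite mem_setE in_itv/= => /[dup] st /andP[s0 _].
  by rewrite EZG// aEs// bE// -/z; ring.
have ie : mu.-integrable `[0, t] (EFin \o (fun s => e s)).
  by apply: continuous_itv_integrable; exact: continuous_discount.
have mI : measurable ([set` `[0, t]] : set (measurableTypeR R)) by exact: measurable_itv.
have imz := integrableZl_EFin mI (m0 * z) ie.
have mb : measurable_fun `[0, t] b.
  by apply/measurable_EFinP; exact: measurable_int ib.
have ieb : mu.-integrable `[0, t] (EFin \o (fun s => e s * b s)).
  apply: le_integrable ib => //.
    apply/measurable_EFinP/measurable_funM.
      exact: measurable_funTS (measurable_discount gamma t).
    exact: mb.
  move=> s /=; rewrite in_itv/= => /andP[_ st].
  by rewrite lee_fin normrM ler_piMl// (ger0_norm (expR_ge0 _)) discount_le1.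
rewrite RintegralD//; last exact: integrableD_EFin.
(* The initial value keeps the factor [1 - gamma * ((1 - expR (- gamma * t)) / gamma)], which is
   [expR (- gamma * t)]; [va] merges the two drift terms. *)
rewrite RintegralD// RintegralZl// Rintegral_discount0// -va.
by field; rewrite gt_eqF.
Qed.

End volterra_moments.

(** * Mean and variance *)

Section stationary_covariance.
Context (R : realType) (d : nat).
Variables (Q : 'M[R]_d) (p alpha : 'I_d -> R).
Local Notation mu := (@lebesgue_measure R).

Definition autocovariance (v : R) : R :=
  \sum_i \sum_j alpha i * alpha j * (p i * (transition Q v i j - p j)).

Lemma autocovarianceE v :
  \sum_i \sum_j alpha i * alpha j * (p i * transition Q v i j) =
  autocovariance v + (\sum_i p i * alpha i) ^+ 2.
Proof.
rewrite expr2 big_distrl -big_split /=; apply: eq_bigr => i _.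
rewrite big_distrr -big_split /=; apply: eq_bigr => j _; ring.
Qed.

Let continuous_term i j :
  continuous (fun v : R => p i * (transition Q v i j - p j)).
Proof.
move=> v; apply: cvgMr; apply: cvgB; last exact: cvg_cst.
exact: continuous_transition.
Qed.

Lemma continuous_autocovariance : continuous autocovariance.
Proof.
move=> v; rewrite /autocovariance.
apply: cvg_big => [|i _]; first exact: add_continuous.
apply: cvg_big => [|j _]; first exact: add_continuous.
by apply: cvgMr; exact: continuous_term.
Qed.

Lemma Rintegral_autocovariance (k : R -> R) (t : R) : continuous k ->
  \int[mu]_(v in `[0, t]) (k v * autocovariance v) =
  \sum_i \sum_j alpha i * alpha j *
    \int[mu]_(v in `[0, t]) (k v * (p i * (transition Q v i j - p j))).
Proof.
move=> ck.
have mI : measurable ([set` `[0, t]] : set (measurableTypeR R)) by exact: measurable_itv.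
have iij i j : mu.-integrable `[0, t]
    (EFin \o (fun v => k v * (p i * (transition Q v i j - p j)))).
  apply: continuous_itv_integrable => v; apply: cvgM; first exact: ck.
  exact: continuous_term.
transitivity (\int[mu]_(v in `[0, t]) (\sum_i \sum_j alpha i * alpha j *
    (k v * (p i * (transition Q v i j - p j))))).
  apply: eq_Rintegral => v _; rewrite big_distrr; apply: eq_bigr => i _.
  by rewrite big_distrr; apply: eq_bigr => j _ /=; ring.
have iaij i j : mu.-integrable `[0, t] (EFin \o (fun v => alpha i * alpha j *
    (k v * (p i * (transition Q v i j - p j))))).
  exact: (integrableZl_EFin mI).
rewrite (Rintegral_sum mI); last by move=> i; exact: (integrable_sum_EFin mI).
apply: eq_bigr => i _; rewrite (Rintegral_sum mI)//.
by apply: eq_bigr => j _; rewrite (RintegralZl _ mI).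
Qed.

End stationary_covariance.

Lemma expectation_variance (R : realType) (disp : measure_display)
    (T : measurableType disp) (P : probability T R) (M : {RV P >-> R}) (f : T -> R) :
  L2 P setT f -> {ae P, forall w, M w = f w} ->
  'E_P[M]%E = (\int[P]_w f w)%:E /\
  'V_P[M] = (\int[P]_w f w ^+ 2 - (\int[P]_w f w) ^+ 2)%:E.
Proof.
move=> Lf Mf; have LM : L2 P setT M by have [] := L2_ae (measurable_funPT M) Lf Mf.
have E1 : \int[P]_w M w = \int[P]_w f w.
  by apply: ae_Rintegral => //; exact: Lf.1.
have E2 : \int[P]_w M w ^+ 2 = \int[P]_w f w ^+ 2.
  by have [] := L2_ae (measurable_funPT M) Lf Mf.
have iM := L2_integrable LM.
have EM : 'E_P[M]%E = (\int[P]_w f w)%:E.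
  rewrite unlock -E1 /Rintegral fineK//; exact: integrable_fin_num iM.
split=> //; rewrite -E1 -E2; set m := \int[P]_w M w.
have L1 : L2 P setT (fun=> m) by apply: (@L2_prob_bounded _ _ _ _ _ `|m|).
have LB := L2B measurableT LM L1.
have -> : 'V_P[M] = (\int[P]_w ((M w - m) ^+ 2)%:E)%E.
  rewrite /variance unlock EM /= -E1 -/m unlock.
  by apply: eq_integral => w _ /=; rewrite expr2.
rewrite -[LHS]fineK; last exact: integrable_fin_num LB.2.
congr EFin; rewrite -/(Rintegral _ _ _).
transitivity (\int[P]_w (M w ^+ 2 + (m ^+ 2 + - (2 * m) * M w))).
  by apply: eq_Rintegral => w _; ring.
have iZ := integrableZl_EFin measurableT (- (2 * m)) iM.
have ic := L2_integrable (@L2_prob_bounded _ _ _ P (fun=> m ^+ 2) `|m ^+ 2|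
  (measurable_cst _) (fun=> lexx _)).
rewrite RintegralD//; [|exact: LM.2|exact: integrableD_EFin].
rewrite RintegralD// Rintegral_prob_cst RintegralZl// -/m; ring.
Qed.

Theorem proposition3p1 (R : realType) (disp : measure_display)
    (T : measurableType disp) (P : probability T R) (d : nat)
    (Q : 'M[R]_d) (p : 'I_d -> R) (X : R -> T -> 'I_d)
    (B : R -> {RV P >-> R}) (m0 : R) (alpha sigma : 'I_d -> R) (gamma : R)
    (M : R -> {RV P >-> R})
    (hQ : is_generator Q) (hp : is_unique_invariant Q p)
    (hX : is_markov_chain P Q X)
    (hX0 : forall i, P (X 0 @^-1` [set i]) = (p i)%:E)
    (hB : is_brownian_motion B) (hXB : independent_processes X B)
    (hgamma : 0 < gamma) (hM : is_mmou X B m0 alpha gamma sigma M)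
    (t : R) (ht : 0 <= t) :
  'E_P[M t]%E =
    (m0 * expR (- gamma * t)
     + (\sum_i p i * alpha i) / gamma * (1 - expR (- gamma * t)))%:E /\
  'V_P[M t] =
    ((\sum_i p i * sigma i ^+ 2)
       * ((1 - expR (- 2 * gamma * t)) / (2 * gamma))
     + \sum_i \sum_j alpha i * alpha j *
         \int[lebesgue_measure]_(v in `[0, t])
           ((expR (- gamma * v) - expR (- gamma * (2 * t - v))) / gamma
            * (p i * (transition Q v i j - p j))))%:E.
Proof.
have gamma0 : gamma != 0 by rewrite gt_eqF.
have mI : measurable ([set` `[0, t]] : set (measurableTypeR R)) by exact: measurable_itv.
case: hp => -[_ pQ] _; case: hM => cMae [I hI eqM].
have [N mN [PN cN]] := ae_measurable_modification cMae.
have mX : forall (s : R) i, 0 <= s -> measurable (X s @^-1` [set i]) by case: hX.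
set v := \sum_i p i * sigma i ^+ 2; set a := \sum_i p i * alpha i.

(* Moments of the chain and of the Ito integral *)
have jm phi := chain_jointly_measurable hX phi.
have mSX : measurable_fun setT
    (fun z : T * measurableTypeR R => sigma (X (Num.max z.2 0) z.1)).
  exact: (measurableT_comp (jm sigma) (@measurable_swap _ _ _ _)).
have ESX (s : R) : 0 <= s -> (\int[P]_w (sigma (X s w) ^+ 2)%:E = v%:E)%E.
  move=> s0; have <- : \int[P]_w (sigma (X s w) ^+ 2) = v.
    exact: (chain_expectation hX hX0 pQ (fun i => sigma i ^+ 2) s0).
  rewrite /Rintegral fineK//; apply: integrable_fin_num => //.
  exact: L2_integrable (chain_L2 hX (fun i => sigma i ^+ 2) s0).
have LI (s : R) : 0 <= s -> L2 P setT (I s) by move=> s0; exact: (ito_L2 mX hB hXB hI).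
have cov (r s : R) : 0 <= r -> 0 <= s -> \int[P]_w (I r w * I s w) = v * Num.min r s.
  move=> r0 s0; have [rs|sr] := leP r s.
    by apply: (ito_covariance mX hB hXB hI mSX ESX); rewrite r0.
  under eq_Rintegral do rewrite mulrC.
  by apply: (ito_covariance mX hB hXB hI mSX ESX); rewrite s0 ltW.
have EI (s : R) : 0 <= s -> \int[P]_w I s w ^+ 2 = v * s.
  by move=> s0; under eq_Rintegral do rewrite expr2; rewrite cov// minxx.
pose Y (u : R) (w : T) := alpha (X (Num.max u 0) w).
have [K K0 YK'] := chain_bounded X alpha.
have YK u w : `|Y u w| <= K by exact: YK'.
have mY : measurable_fun setT (fun z : measurableTypeR R * T => Y z.1 z.2).
  exact: jm alpha.
have YE u w : 0 <= u -> Y u w = alpha (X u w) by move=> u0; rewrite /Y max_l.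
(* M is only continuous off a null set: replace it there by 0 *)
pose Mc (s : R) (w : T) := M (Num.max s 0) w * \1_(~` N) w.
have cM w : continuous (fun s => Mc s w).
  have [Nw|Nw] := pselect (N w).
    have -> : (fun s => Mc s w) = cst 0.
      apply/funext => s; rewrite /Mc indicE memNset ?mulr0//; exact.
    by move=> s; exact: cvg_cst.
  by move=> s; apply: cvgMl; exact: continuous_comp_max (cN w Nw) s.
have mMc s : 0 <= s -> measurable_fun setT (Mc s).
  move=> s0; apply: measurable_funM => //.
  by apply: measurable_indic; exact: measurableC.
have aeN : {ae P, forall w, ~ N w}.
  by exists N; split => // w /= /contrapT.
have McE s w : 0 <= s -> ~ N w -> Mc s w = M s w.
  by move=> s0 Nw; rewrite /Mc max_l// indicE mem_set// mulr1.
have hMc s : 0 <= s -> {ae P, forall w, Mc s w =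
    m0 + (\int[lebesgue_measure]_(u in `[0, s]) Y u w
      - gamma * \int[lebesgue_measure]_(u in `[0, s]) Mc u w) + I s w}.
  move=> s0; apply: filterS2 (eqM s s0) aeN => w Ms Nw.
  have iMc := continuous_itv_integrable 0 s (@cM w).
  have iY : lebesgue_measure.-integrable `[0, s] (EFin \o (Y ^~ w)).
    exact: bounded_section_integrable mY YK w s.
  rewrite McE// Ms; congr (_ + _ + _).
  rewrite -RintegralZl// -RintegralB//; last exact: integrableZl_EFin.
  apply: eq_Rintegral => u; rewrite mem_setE in_itv/= => /andP[u0 _].
  by rewrite McE// YE.

(* Moments of the process by successive choices of the test variable *)
have LM := volterra_L2 hgamma ht mY YK LI EI cM mMc hMc.
have star := volterra_moment hgamma ht mY YK LI EI cM mMc hMc.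
pose e s := expR (- gamma * (t - s)); pose e0 := expR (- gamma * t).
pose kappa := (1 - e0) / gamma.
have e00 : e 0 = e0 by rewrite /e subr0.
have ett : e t = 1 by rewrite /e subrr mulr0 expR0.
have ce : continuous e by exact: continuous_discount.
have ie : lebesgue_measure.-integrable `[0, t] (EFin \o e).
  exact: continuous_itv_integrable.
have Ie : \int[lebesgue_measure]_(s in `[0, t]) e s = kappa.
  exact: Rintegral_discount0.
have i0 : lebesgue_measure.-integrable `[0, t] (EFin \o (fun=> 0 : R)).
  by apply: continuous_itv_integrable => x; exact: cvg_cst.
have LY (u : R) : L2 P setT (Y u).
  apply: (@L2_prob_bounded _ _ _ _ _ K) => //.
  exact: (measurableT_comp mY (measurable_pair1 u)).
have L1 : L2 P setT (fun=> 1 : R).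
  by apply: (@L2_prob_bounded _ _ _ _ _ 1) => // w; rewrite normr1.
have EY u : 0 <= u -> \int[P]_w Y u w = a.
  move=> u0; under eq_Rintegral do rewrite YE//.
  exact: (chain_expectation hX hX0 pQ alpha u0).
have EYI u s : 0 <= s -> \int[P]_w (Y u w * I s w) = 0.
  move=> s0; apply: (ito_orthogonal mX hB hXB hI s0) => //.
  by apply: chain_past; rewrite le_max lexx orbT.
have EI0 s : 0 <= s -> \int[P]_w (1 * I s w) = 0.
  move=> s0; apply: (ito_orthogonal mX hB hXB hI s0) => //.
  move=> r; exact: (@chain_past _ _ _ P _ X B (fun=> 1) 0 (lexx 0) r).
have Ic (c : R) : \int[lebesgue_measure]_(s in `[0, t]) (e s * c) = kappa * c.
  by rewrite (RintegralZr _ mI ie) Ie.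
(* Test variable 1: the drift has constant expectation [a] and the Ito integral has mean 0. *)
have mean : \int[P]_w Mc t w = m0 * e0 + a * kappa.
  have := star _ (fun=> a) (fun=> 0) L1.
  under [X in _ -> _ -> _ -> X = _]eq_Rintegral do rewrite mul1r.
  move=> ->//.
  - by rewrite Ic Ic Rintegral_prob_cst -/e0; ring.
  - move=> u /andP[u0 _]; under eq_Rintegral do rewrite mul1r.
    exact: EY.
  - by move=> s /andP[s0 _]; exact: EI0.
(* Test variable [I r]: it is centred and orthogonal to the drift, so only its covariance
   [v * Num.min s r] with [I s] contributes. *)
have EIM r : 0 <= r <= t -> \int[P]_w (Mc t w * I r w) = v * (e r - e0) / gamma.
  move=> /[dup] rt /andP[r0 _]; under eq_Rintegral do rewrite mulrC.
  have cmin : continuous (fun s : R => v * Num.min s r).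
    by move=> s; apply: cvgMr; apply: continuous_min; [exact: cvg_id|exact: cvg_cst].
  rewrite (star _ (fun=> 0) (fun s => v * Num.min s r) (LI r r0)).
  - rewrite Ic mulr0 addr0.
    have -> : \int[P]_w I r w = 0.
      by rewrite -(EI0 r r0); apply: eq_Rintegral => w _; rewrite mul1r.
    have -> : \int[lebesgue_measure]_(s in `[0, t])
        (expR (- gamma * (t - s)) * (v * Num.min s r)) =
        v * ((r - (e r - e0) / gamma) / gamma).
      rewrite -e00 -(Rintegral_discount_min hgamma rt) -(RintegralZl _ mI).
        by apply: eq_Rintegral => s _; ring.
      apply: continuous_itv_integrable => s; apply: cvgM; first exact: ce.
      by apply: continuous_min; [exact: cvg_id|exact: cvg_cst].
    have -> : Num.min t r = r by case/andP: rt => _ ?; rewrite min_r.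
    by field.
  - move=> u _; rewrite -[RHS](EYI u r r0).
    by apply: eq_Rintegral => w _; rewrite mulrC.
  - by move=> s /andP[s0 _]; rewrite cov// minC.
  - exact: continuous_itv_integrable.
have cc := @continuous_autocovariance _ _ Q p alpha.
set c := autocovariance Q p alpha.
have EYY u s : 0 <= u -> 0 <= s ->
    \int[P]_w (Y u w * Y s w) = c `|u - s| + a ^+ 2.
  have half (x y : R) : 0 <= x <= y -> \int[P]_w (Y x w * Y y w) = c (y - x) + a ^+ 2.
    move=> /[dup] xy /andP[x0 xy']; rewrite -autocovarianceE.
    rewrite -(chain_expectation2 hX hX0 pQ alpha alpha xy).
    by apply: eq_Rintegral => w _; rewrite !YE// (le_trans x0).
  move=> u0 s0; have [us|su] := leP u s.
    by rewrite half ?u0// ler0_norm ?subr_le0// opprB.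
  under eq_Rintegral do rewrite mulrC.
  by rewrite half ?s0 ?ltW// gtr0_norm ?subr_gt0.
pose J u := \int[lebesgue_measure]_(s in `[0, t]) (e s * c `|u - s|).
(* Test variable [Y u]: it is orthogonal to the Ito integral, and its products with [Y s] bring in
   the autocovariance. *)
have EYM u : 0 <= u <= t ->
    \int[P]_w (Mc t w * Y u w) = m0 * e0 * a + J u + kappa * a ^+ 2.
  move=> /andP[u0 ut]; under eq_Rintegral do rewrite mulrC.
  rewrite (star _ (fun s => c `|u - s| + a ^+ 2) (fun=> 0) (LY u))//; last 2 first.
  - by move=> s /andP[s0 _]; exact: EYY.
  - by move=> s /andP[s0 _]; exact: EYI.
  rewrite Ic EY// mulr0 mulr0 subr0 addr0 -addrA; congr (_ + _).
  rewrite -Ic -RintegralD//.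
  - by apply: eq_Rintegral => s _; rewrite mulrDr.
  - apply: continuous_itv_integrable => s; apply: cvgM; first exact: ce.
    apply: (cvg_comp (fun s : R => `|u - s|) c); last exact: cc.
    by apply: cvg_norm; apply: cvgB; [exact: cvg_cst|exact: cvg_id].
  - by apply: continuous_itv_integrable => s; apply: cvgMl; exact: ce.
(* By [EYM], [J u] differs by a constant from the expectation of [Mc t * Y u], which is already
   known to be integrable in [u]. *)
have iJ : lebesgue_measure.-integrable `[0, t] (EFin \o (fun u => e u * J u)).
  have iYM := volterra_drift_integrable ht mY YK LM.
  have icst : lebesgue_measure.-integrable `[0, t]
      (EFin \o (fun=> m0 * e0 * a + kappa * a ^+ 2)).
    by apply: continuous_itv_integrable => x; exact: cvg_cst.
  have iJ' : lebesgue_measure.-integrable `[0, t] (EFin \o J).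
    have := integrableB_EFin mI iYM icst; apply: eq_integrable => // u.
    rewrite mem_setE in_itv/= => ut; rewrite /= EYM//; congr EFin; ring.
  have mJ : measurable_fun `[0, t] J.
    by apply/measurable_EFinP; exact: measurable_int iJ'.
  apply: le_integrable iJ' => //.
    apply/measurable_EFinP/measurable_funM => //.
    exact: measurable_funTS (measurable_discount gamma t).
  move=> u /=; rewrite in_itv/= => /andP[_ ut].
  by rewrite lee_fin normrM ler_piMl// (ger0_norm (expR_ge0 _)) discount_le1.
(* Test variable [Mc t] itself: [EYM] and [EIM] are its two inputs. *)
have second : \int[P]_w Mc t w ^+ 2 = m0 * e0 * (m0 * e0 + a * kappa) +
    ((m0 * e0 * a + kappa * a ^+ 2) * kappa +
     \int[lebesgue_measure]_(u in `[0, t]) (e u * J u)) +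
    v * ((1 - expR (- 2 * gamma * t)) / (2 * gamma)).
  have cb : continuous (fun s => v * (e s - e0) / gamma).
    move=> s; apply: cvgMl; apply: cvgMr; apply: cvgB; [exact: ce|exact: cvg_cst].
  under eq_Rintegral do rewrite expr2.
  rewrite (star _ (fun u => m0 * e0 * a + J u + kappa * a ^+ 2)
    (fun s => v * (e s - e0) / gamma) LM EYM EIM (continuous_itv_integrable 0 t cb)).
  rewrite mean -/e0; congr (_ + _ + _).
    transitivity (\int[lebesgue_measure]_(u in `[0, t])
       ((m0 * e0 * a + kappa * a ^+ 2) * e u + e u * J u)).
      by apply: eq_Rintegral => u _; rewrite -/(e u); ring.
    rewrite RintegralD//; last exact: integrableZl_EFin.
    by rewrite (RintegralZl _ mI ie) Ie.
  (* The Ito part needs the integral of [e s * e s], a discount at rate [2 * gamma]. It amounts to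
     [v] times [(1 - e0) / gamma - (1 - e0 ^+ 2) / (2 * gamma) + e0 * (1 - e0) / gamma], that is
     [(1 - e0 ^+ 2) / (2 * gamma)]. *)
  have e2 : \int[lebesgue_measure]_(s in `[0, t]) (expR (- (2 * gamma) * (t - s))) =
      (1 - expR (- 2 * gamma * t)) / (2 * gamma).
    rewrite Rintegral_discount ?mulf_neq0 ?pnatr_eq0// subr0.
    by rewrite mulNr mulNr.
  have -> : \int[lebesgue_measure]_(s in `[0, t])
      (expR (- gamma * (t - s)) * (v * (e s - e0) / gamma)) =
      \int[lebesgue_measure]_(s in `[0, t])
       (v / gamma * expR (- (2 * gamma) * (t - s)) - v / gamma * e0 * e s).
    apply: eq_Rintegral => s _; rewrite -/(e s).
    have -> : expR (- (2 * gamma) * (t - s)) = e s * e s.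
      by rewrite /e -expRD; congr expR; ring.
    ring.
  have i2 : lebesgue_measure.-integrable `[0, t]
      (EFin \o (fun s => expR (- (2 * gamma) * (t - s)))).
    by apply: continuous_itv_integrable; exact: continuous_discount.
  rewrite RintegralB//; [|exact: integrableZl_EFin|exact: integrableZl_EFin].
  rewrite (RintegralZl _ mI i2) (RintegralZl _ mI ie) Ie e2 ett /kappa.
  have -> : expR (- 2 * gamma * t) = e0 * e0.
    by rewrite /e0 -expRD; congr expR; ring.
  by field.
have Mt : {ae P, forall w, M t w = Mc t w}.
  by apply: filterS aeN => w Nw; rewrite McE.
have [-> ->] := expectation_variance LM Mt.
split; first by rewrite mean /kappa -/e0; congr EFin; field.
(* The terms without [J] and [v] form [(m0 * e0 + a * kappa) ^+ 2], the square of the mean, and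
   cancel. *)
rewrite second mean (discount_reflect hgamma ht cc) -Rintegral_autocovariance.
  by congr EFin; ring.
move=> x; apply: cvgMl; apply: cvgB.
  apply: (cvg_comp _ expR); last exact: continuous_expR.
  by apply: cvgMr; exact: cvg_id.
apply: (cvg_comp _ expR); last exact: continuous_expR.
by apply: cvgMr; apply: cvgB; [exact: cvg_cst|exact: cvg_id].
Qed.
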